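(* In the setting of the context, assume (G1), (G2), (G3), and suppose (HJ) holds: there exist $\alpha_2\in(0,1)$ and $c_J\ge1$ such that for all $x\in X_0$, $0<r<\alpha_2R_0(x)$ and $y\in U(x,\alpha_2^2r)$, $\mu_x^{U(x,\alpha_2r)}(E)\le c_J\mu_y^{U(x,r)}(E)$ for every Borel $E\subseteq X\setminus U(x,r)$. Let $M:=(2c_D^2c^2c_1^2)\vee(3cc_2)$, let $k\in\mathbb N$ with $M\le M_0^k$ and $\alpha_0^k<1/4$, $\alpha_M:=\alpha_0^k$, and let $0<\alpha\le(\alpha_M\wedge\alpha_2)/4$. Then there exists $K\ge1$ such that for all $x\in X_0$ and $0<R<R_0(x)$, $$\sup_{U(x,\alpha R)}h\le K\inf_{U(x,\alpha R)}h\qquad\text{for all }h\in\mathcal H^+(U(x,R)).$$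
   Context: $(X,\rho)$ separable metric space, $X_0\subseteq X$ open; $\mathcal M(X)$ finite Borel measures (extended to universally measurable sets), $\|\mu\|=\mu(X)$, $\varepsilon_x$ Dirac measure. For every open $U\subseteq X$ and $x\in X$ a measure $\mu_x^U\in\mathcal M(X)$ is given such that for all open $U,V$ and $x$: $\mu_x^U(U)=0$, $\|\mu_x^U\|\le1$, $\mu_x^U=\varepsilon_x$ if $x\notin U$; $y\mapsto\mu_y^U(E)$ universally measurable for Borel $E$; $\mu_x^U=\int\mu_y^U\,d\mu_x^V(y)$ if $V\subseteq U$. For closed $A$, $\varepsilon_x^A:=\mu_x^{X\setminus A}$. For open $U$, $\mathcal H(U)$ is the set of universally measurable real $h$ on $X$ such that for every open $V$ with $\overline V\subseteq U$ and $x\in V$, $h$ is $\mu_x^V$-integrable with $\int h\,d\mu_x^V=h(x)$; $\mathcal H^+(U)$ its nonnegative elements. $\mathcal U(X_0)$: open $U$ with $\overline U\subseteq X_0$; $U(x,r)$ open ball; $R_0(x):=\sup\{r>0:\overline{U(x,r)}\subseteq X_0\}$. $G\colon X\times X\to(0,\infty]$ Borel, $G\mu(x)=\int G(x,y)d\mu(y)$, $\operatorname{cap}A:=\sup\{\|\mu\|:\mu\in\mathcal M(X),\mu(X\setminus A)=0,G\mu\le1\}$. (G1): there is $c_1\ge1$ such that for all $U\in\mathcal U(X_0)$, $x\in U$, $\delta>0$, closed $A\subseteq U$ there are a closed neighborhood $B\subseteq U$ of $A$ and a measure $\nu$ carried by $B$ with $\|\varepsilon_x^B\|-\delta<c_1\|\varepsilon_x^A\|$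 and $\|\varepsilon_y^A\|\le G\nu(y)\le c_1\|\varepsilon_y^B\|$ for all $y$. (G2): there are a strictly decreasing continuous $g\colon[0,\infty)\to(0,\infty]$ and $c,c_D,M_0\in[1,\infty)$, $\alpha_0\in(0,1)$ with $g(r/2)\le c_Dg(r)$, $M_0g(r)\le g(\alpha_0r)$ for all $r>0$ and $c^{-1}g\circ\rho\le G\le c\,g\circ\rho$. (G3): there is $c_2\ge1$ with $\operatorname{cap}U(x,r)\ge c_2^{-1}g(r)^{-1}$ for all $x\in X_0$, $0<r<R_0(x)$. *)

(* Defs.v *)
From HB Require Import structures.
From mathcomp Require Import all_boot all_order all_algebra.
From mathcomp Require Import all_classical all_reals all_analysis measurable_realfun.
Set Implicit Arguments. Unset Strict Implicit. Unset Printing Implicit Defensive.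
Import Order.TTheory GRing.Theory Num.Theory.
Import numFieldNormedType.Exports.
Local Open Scope classical_set_scope.
Local Open Scope ring_scope.

Section Defs.
Context {R : realType} {d : measure_display} {X : measurableType d}.
Variable rho : X -> X -> R.

Definition is_metric : Prop :=
  (forall x y, 0 <= rho x y) /\ (forall x y, rho x y = 0 <-> x = y) /\
  (forall x y, rho x y = rho y x) /\
  (forall x y z, rho x z <= rho x y + rho y z).

Definition rball (x : X) (r : R) : set X := [set y | rho x y < r].

Definition ropen (A : set X) : Prop :=
  forall x, A x -> exists r : R, 0 < r /\ rball x r `<=` A.
Definition rclosed (A : set X) : Prop := ropen (~` A).
Definition rclosure (A : set X) : set X :=
  [set x | forall e : R, 0 < e -> exists y, A y /\ rho x y < e].

Definition separable : Prop :=
  exists D : set X, countable D /\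
    forall (x : X) (e : R), 0 < e -> exists y, D y /\ rho x y < e.

Definition borel_space : Prop := (@measurable d X) = <<s ropen >>.

(* universally measurable sets / functions (completion w.r.t. every
   finite Borel measure) *)
Definition umeasurable (A : set X) : Prop :=
  forall nu : {finite_measure set X -> \bar R},
    exists B1 B2, measurable B1 /\ measurable B2 /\ B1 `<=` A /\ A `<=` B2 /\
      nu (B2 `\` B1) = 0%E.

Definition umeasurable_fun {d' : measure_display} {T : measurableType d'}
    (f : X -> T) : Prop :=
  forall B : set T, measurable B -> umeasurable (f @^-1` B).

(* integral w.r.t. the completion of nu: f agrees outside a Borel nu-null
   set with a Borel function f' whose integral is v *)
Definition cintegral_is (nu : {finite_measure set X -> \bar R})
    (f : X -> \bar R) (v : \bar R) : Prop :=
  exists (f' : X -> \bar R) (N : set X),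
    measurable_fun setT f' /\ measurable N /\ nu N = 0%E /\
    (forall y, ~ N y -> f y = f' y) /\ (\int[nu]_y f' y)%E = v.

Definition cintegrable_is (nu : {finite_measure set X -> \bar R})
    (f : X -> \bar R) (v : \bar R) : Prop :=
  exists (f' : X -> \bar R) (N : set X),
    nu.-integrable setT f' /\ measurable N /\ nu N = 0%E /\
    (forall y, ~ N y -> f y = f' y) /\ (\int[nu]_y f' y)%E = v.

(* mu U x = mu_x^U ; only the values for open U matter *)
Definition harmonic_family
    (mu : set X -> X -> {finite_measure set X -> \bar R}) : Prop :=
  forall U, ropen U -> forall x,
    mu U x U = 0%E /\ (mu U x setT <= 1)%E /\
    (~ U x -> forall E, measurable E -> mu U x E = \d_x E) /\
    (forall E, measurable E -> umeasurable_fun (fun y => mu U y E)) /\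
    (forall V, ropen V -> V `<=` U -> forall E, measurable E ->
       cintegral_is (mu V x) (fun y => mu U y E) (mu U x E)).

Definition normeps (mu : set X -> X -> {finite_measure set X -> \bar R})
    (A : set X) (x : X) : \bar R := mu (~` A) x setT.

Definition harmonic (mu : set X -> X -> {finite_measure set X -> \bar R})
    (U : set X) (h : X -> R) : Prop :=
  umeasurable_fun h /\
  forall V, ropen V -> rclosure V `<=` U -> forall x, V x ->
    cintegrable_is (mu V x) (fun y => (h y)%:E) (h x)%:E.

Definition harmonic_pos (mu : set X -> X -> {finite_measure set X -> \bar R})
    (U : set X) (h : X -> R) : Prop :=
  harmonic mu U h /\ forall y, 0 <= h y.

Definition Gpot (G : X -> X -> \bar R) (nu : {finite_measure set X -> \bar R})
    (y : X) : \bar R := (\int[nu]_z G y z)%E.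

Definition cap (G : X -> X -> \bar R) (A : set X) : \bar R :=
  ereal_sup [set nu setT | nu in
    [set nu : {finite_measure set X -> \bar R} |
       nu (~` A) = 0%E /\ forall y, (Gpot G nu y <= 1)%E]].

Definition R0 (X0 : set X) (x : X) : \bar R :=
  ereal_sup [set r%:E | r in [set r : R | 0 < r /\ rclosure (rball x r) `<=` X0]].

Definition Gkernel (G : X -> X -> \bar R) : Prop :=
  measurable_fun setT (fun p : X * X => G p.1 p.2) /\
  forall x y, (0 < G x y)%E.

Definition G1 (X0 : set X) (mu : set X -> X -> {finite_measure set X -> \bar R})
    (G : X -> X -> \bar R) (c1 : R) : Prop :=
  1 <= c1 /\
  forall U, ropen U -> rclosure U `<=` X0 -> forall x, U x ->
  forall delta : R, 0 < delta -> forall A, rclosed A -> A `<=` U ->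
  exists B, rclosed B /\ B `<=` U /\
    (forall a, A a -> exists r : R, 0 < r /\ rball a r `<=` B) /\
    exists nu : {finite_measure set X -> \bar R},
      nu (~` B) = 0%E /\
      (normeps mu B x - delta%:E < c1%:E * normeps mu A x)%E /\
      forall y, (normeps mu A y <= Gpot G nu y)%E /\
                (Gpot G nu y <= c1%:E * normeps mu B y)%E.

Definition G2 (G : X -> X -> \bar R) (g : R -> \bar R)
    (c cD M0 alpha0 : R) : Prop :=
  1 <= c /\ 1 <= cD /\ 1 <= M0 /\ 0 < alpha0 < 1 /\
  (forall r : R, 0 <= r -> (0 < g r)%E) /\
  (forall s t : R, 0 <= s -> s < t -> (g t < g s)%E) /\
  {within `[0, +oo[, continuous g} /\
  (forall r : R, 0 < r -> (g (r / 2)%R <= cD%:E * g r)%E) /\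
  (forall r : R, 0 < r -> (M0%:E * g r <= g (alpha0 * r)%R)%E) /\
  (forall x y, ((c^-1)%R%:E * g (rho x y) <= G x y)%E /\
               (G x y <= c%:E * g (rho x y))%E).

Definition G3 (X0 : set X) (G : X -> X -> \bar R) (g : R -> \bar R)
    (c2 : R) : Prop :=
  1 <= c2 /\
  forall (x : X) (r : R), X0 x -> 0 < r -> (r%:E < R0 X0 x)%E ->
    ((c2^-1 * (fine (g r))^-1)%R%:E <= cap G (rball x r))%E.

Definition HJ (X0 : set X) (mu : set X -> X -> {finite_measure set X -> \bar R})
    (alpha2 cJ : R) : Prop :=
  0 < alpha2 < 1 /\ 1 <= cJ /\
  forall (x : X) (r : R) (y : X), X0 x -> 0 < r -> (r%:E < alpha2%:E * R0 X0 x)%E ->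
    rball x (alpha2 ^+ 2 * r) y ->
    forall E, measurable E -> E `<=` ~` rball x r ->
      (mu (rball x (alpha2 * r)%R) x E <= cJ%:E * mu (rball x r) y E)%E.

End Defs.

(* Main.v *)
Require Import Defs.
From HB Require Import structures.
From mathcomp Require Import all_boot all_order all_algebra.
From mathcomp Require Import all_classical all_reals all_analysis measurable_realfun.
From mathcomp Require Import ring lra.
Import Order.TTheory GRing.Theory Num.Theory.
Import numFieldNormedType.Exports.
Import HBNNSimple.
Local Open Scope classical_set_scope.
Local Open Scope ring_scope.
Set Implicit Arguments. Unset Strict Implicit. Unset Printing Implicit Defensive.

(** Fix a ball of radius [R] and a nonnegative harmonic [h].  (G1) and (G2) bound
    from below, by [g r] times the mass of any measure on [A] with potential at
    most 1, the probability of hitting a closed set [A] before leaving a ball of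
    radius [r].  By (G3), around any point [y] one of the two sets [h <= t] and
    [t < h] in a small ball carries a closed subset of comparable capacity.  If
    [t = zeta * h y] is large compared with [h z0], the second alternative
    contradicts [h z0 >= t * P(hit)].  In the first one, the exit measure of the
    small ball without the closed set [C] charges [C], where [h <= t], and the
    far away part is at most [cJ * t] by (HJ), so [h] must exceed [h y] by a fixed
    factor somewhere near [y].  This is impossible at a near maximiser of [h]
    times a power of the distance to the boundary of the ball.  Such points exist
    only if [h] is bounded, so [h] is first replaced by [v x], the integral of a
    simple function [f <= h] against the exit measure at [x] of the ball of radius
    [R / 2]; [v <= h] is bounded, still satisfies the mean value property, and [h]
    is the supremum of these [v]. *)

(** * Lower and completed integrals *)

Lemma measurable_fun_mem {d : measure_display} {T : measurableType d} (A : set T) :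
  measurable A -> measurable_fun setT (fun x => x \in A).
Proof.
move=> mA; apply: (measurable_fun_bool true); rewrite setTI.
rewrite (_ : _ @^-1` _ = A)//.
by apply/seteqP; split => x; [exact: set_mem|exact: mem_set].
Qed.

Section lower_integral.
Context {d : measure_display} {T : measurableType d} {R : realType}.
Variable nu : {measure set T -> \bar R}.
Implicit Types f phi : T -> \bar R.
Local Open Scope ereal_scope.

(* The integral of a nonnegative, possibly non measurable, function is its lower
   integral; the monotonicity lemmas below need no measurability of [f]. *)
Lemma lower_integral_le f1 f2 : (forall x, 0 <= f1 x) ->
  (forall x, f1 x <= f2 x) -> \int[nu]_x f1 x <= \int[nu]_x f2 x.
Proof.
move=> f10 f12.
rewrite !ge0_integralTE//; last by move=> x; exact: le_trans (f12 x).
apply: ge_ereal_sup => _ [h /= hf <-]; apply: ereal_sup_ubound.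
by exists h => //= x; exact: le_trans (f12 x).
Qed.

(** Raising [phi] to [+oo] on the null set [N] keeps its integral and makes the comparison hold
    everywhere, so [f] may stay non measurable. *)
Lemma lower_integral_le_ae f phi (N : set T) : measurable N -> nu N = 0 ->
  measurable_fun setT phi -> (forall x, 0 <= phi x) -> (forall x, 0 <= f x) ->
  (forall x, ~ N x -> f x <= phi x) -> \int[nu]_x f x <= \int[nu]_x phi x.
Proof.
move=> mN N0 mphi phi0 f0 fphi.
pose psi x := if x \in N then +oo else phi x.
have mpsi : measurable_fun setT psi.
  by apply: measurable_fun_ifT => //; exact: measurable_fun_mem.
have psi0 x : 0 <= psi x by rewrite /psi; case: ifP => // _; exact: leey.
have -> : \int[nu]_x phi x = \int[nu]_x psi x.
  apply: ge0_ae_eq_integral => //; exists N; split => // x /= h.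
  apply: contrapT => Nx; apply: h => _.
  by rewrite /psi ifF//; apply/negbTE/negP; rewrite inE.
apply: lower_integral_le => // x; rewrite /psi; case: ifPn => [_|].
  exact: leey.
by rewrite notin_setE => /fphi.
Qed.

Lemma lower_integral_ge_ae f phi (N : set T) : measurable N -> nu N = 0 ->
  measurable_fun setT phi -> (forall x, 0 <= phi x) -> (forall x, 0 <= f x) ->
  (forall x, ~ N x -> phi x <= f x) -> \int[nu]_x phi x <= \int[nu]_x f x.
Proof.
move=> mN N0 mphi phi0 f0 fphi.
pose psi x := if x \in N then 0 else phi x.
have mpsi : measurable_fun setT psi.
  by apply: measurable_fun_ifT => //; exact: measurable_fun_mem.
have psi0 x : 0 <= psi x by rewrite /psi; case: ifP.
have -> : \int[nu]_x phi x = \int[nu]_x psi x.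
  apply: ge0_ae_eq_integral => //; exists N; split => // x /= h.
  apply: contrapT => Nx; apply: h => _.
  by rewrite /psi ifF//; apply/negbTE/negP; rewrite inE.
apply: lower_integral_le => // x; rewrite /psi; case: ifPn => // .
by rewrite notin_setE => /fphi.
Qed.

End lower_integral.

Section completed_integral.
Context {d : measure_display} {X : measurableType d} {R : realType}.
Variable nu : {finite_measure set X -> \bar R}.
Implicit Types f : X -> \bar R.
Local Open Scope ereal_scope.

(** The absolute value of the given Borel version still agrees with [f] off [N], because [f] is
    nonnegative. *)
Lemma cintegral_is_ge0_version f v : (forall x, 0 <= f x) ->
  cintegral_is nu f v ->
  exists (f' : X -> \bar R) (N : set X),
    [/\ measurable_fun setT f', forall x, 0 <= f' x, measurable N, nu N = 0 &
      (forall y, ~ N y -> f y = f' y) /\ \int[nu]_y f' y = v].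
Proof.
move=> f0 [f' [N [mf' [mN [N0 [ff' <-]]]]]].
exists (fun x => `|f' x|), N; split => //.
  exact: measurableT_comp.
have abs y : ~ N y -> `|f' y| = f' y by move=> /ff' <-; rewrite gee0_abs.
split=> [y Ny|]; first by rewrite abs// ff'.
apply: ae_eq_integral => //; first exact: measurableT_comp.
exists N; split => // x /= h; apply: contrapT => Nx; apply: h => _.
by rewrite abs.
Qed.

(** Identifies the completed integral with the lower integral that [\int] denotes for nonnegative
    functions, so that universally measurable integrands can be compared by plain monotonicity. *)
Lemma cintegral_isE f v : (forall x, 0 <= f x) ->
  cintegral_is nu f v -> v = \int[nu]_x f x.
Proof.
move=> f0 /(cintegral_is_ge0_version f0)[f' [N [mf' f'0 mN N0 [ff' <-]]]].
apply/eqP; rewrite eq_le; apply/andP; split.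
  by apply: (lower_integral_ge_ae mN) => // x /ff' ->.
by apply: (lower_integral_le_ae mN) => // x /ff' ->.
Qed.

Lemma cintegrable_is_cintegral f v : cintegrable_is nu f v -> cintegral_is nu f v.
Proof.
move=> [f' [N [/measurable_int mf' h]]]; by exists f', N.
Qed.

Lemma cintegral_isZ f v (k : R) : (0 <= k)%R -> (forall x, 0 <= f x) ->
  cintegral_is nu f v -> cintegral_is nu (fun x => k%:E * f x) (k%:E * v).
Proof.
move=> k0 f0 /(cintegral_is_ge0_version f0)[f' [N [mf' f'0 mN N0 [ff' <-]]]].
exists (fun x => k%:E * f' x), N; split; first exact: measurable_funeM.
split => //; split => //; split; first by move=> y /ff' ->.
by rewrite ge0_integralZl.
Qed.

Lemma cintegral_isD f1 f2 v1 v2 : (forall x, 0 <= f1 x) -> (forall x, 0 <= f2 x) ->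
  cintegral_is nu f1 v1 -> cintegral_is nu f2 v2 ->
  cintegral_is nu (fun x => f1 x + f2 x) (v1 + v2).
Proof.
move=> f10 f20.
move=> /(cintegral_is_ge0_version f10)[f1' [N1 [mf1 f1'0 mN1 N10 [ff1 <-]]]].
move=> /(cintegral_is_ge0_version f20)[f2' [N2 [mf2 f2'0 mN2 N20 [ff2 <-]]]].
exists (fun x => f1' x + f2' x), (N1 `|` N2); split.
  exact: emeasurable_funD.
split; first exact: measurableU.
split.
  apply/eqP; rewrite eq_le measure_ge0 andbT -[leRHS]adde0 -{1}N10 -N20.
  exact: measureU2.
split; last by rewrite ge0_integralD.
by move=> y /not_orP[/ff1 -> /ff2 ->].
Qed.

Lemma cintegral_is_sum (I : Type) (s : seq I) (F : I -> X -> \bar R)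
    (v : I -> \bar R) : (forall i x, 0 <= F i x) ->
  (forall i, cintegral_is nu (F i) (v i)) ->
  cintegral_is nu (fun x => \sum_(i <- s) F i x) (\sum_(i <- s) v i).
Proof.
move=> F0 Fv; elim: s => [|i s ih].
  under eq_fun do rewrite big_nil; rewrite big_nil.
  by exists (cst 0), set0; do 4 (split => //); rewrite integral0.
under eq_fun do rewrite big_cons; rewrite big_cons.
by apply: cintegral_isD => // x; exact: sume_ge0.
Qed.

End completed_integral.

(** * Balls and regularity of Borel measures *)

Section metric_borel.
Context {R : realType} {d : measure_display} {X : measurableType d}.
Variable rho : X -> X -> R.
Hypothesis rho_metric : is_metric rho.
Hypothesis rho_borel : borel_space rho.

Let rhoxx x : rho x x = 0. Proof. by case: rho_metric => _ [h _]; exact/h. Qed.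
Let rhoC x y : rho x y = rho y x. Proof. by case: rho_metric => _ [_ []]. Qed.
Let rhoD x y z : rho x z <= rho x y + rho y z.
Proof. by case: rho_metric => _ [_ [_]]. Qed.

Lemma rball_center x (r : R) : 0 < r -> rball rho x r x.
Proof. by rewrite /rball /= rhoxx. Qed.

Lemma le_rball x (r s : R) : r <= s -> rball rho x r `<=` rball rho x s.
Proof. by move=> rs y; rewrite /rball /= => /lt_le_trans; exact. Qed.

Lemma rball_subset x y (r s : R) : rho x y + r <= s ->
  rball rho y r `<=` rball rho x s.
Proof.
move=> h z; rewrite /rball /= => yz; apply: lt_le_trans h.
by apply: le_lt_trans (rhoD x y z) _; rewrite ltrD2l.
Qed.

Lemma ropen_rball x (r : R) : ropen rho (rball rho x r).
Proof.
move=> y xy; exists (r - rho x y); split; first by rewrite subr_gt0.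
by apply: rball_subset; rewrite addrC subrK.
Qed.

Lemma rclosure_rball x (r s : R) : r < s ->
  rclosure rho (rball rho x r) `<=` rball rho x s.
Proof.
move=> rs y cy; have [|z [xz yz]] := cy (s - r); first by rewrite subr_gt0.
rewrite /rball /= in xz *; have := rhoD x z y; rewrite (rhoC z y); lra.
Qed.

Lemma rclosureS (A B : set X) : A `<=` B -> rclosure rho A `<=` rclosure rho B.
Proof.
by move=> AB x cx e /cx[y [Ay xy]]; exists y; split => //; exact: AB.
Qed.

Lemma sub_rclosure (A : set X) : A `<=` rclosure rho A.
Proof. by move=> x Ax e e0; exists x; rewrite rhoxx. Qed.

Lemma ropenI A B : ropen rho A -> ropen rho B -> ropen rho (A `&` B).
Proof.
move=> oA oB x [/oA[r [r0 rA]] /oB[s [s0 sB]]].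
exists (Num.min r s); split; first by rewrite lt_min r0.
move=> y xy; split.
  by apply: rA; apply: le_rball xy; rewrite ge_min lexx.
by apply: sB; apply: le_rball xy; rewrite ge_min lexx orbT.
Qed.

Lemma ropen_bigcup (F : nat -> set X) : (forall n, ropen rho (F n)) ->
  ropen rho (\bigcup_n F n).
Proof.
move=> oF x [n _ /oF[r [r0 rF]]]; exists r; split => // y /rF Fy.
by exists n.
Qed.

Lemma ropenD A B : ropen rho A -> rclosed rho B -> ropen rho (A `\` B).
Proof. by rewrite setDE; exact: ropenI. Qed.

Lemma rclosedU A B : rclosed rho A -> rclosed rho B -> rclosed rho (A `|` B).
Proof. by rewrite /rclosed setCU; exact: ropenI. Qed.

Lemma ropen_measurable A : ropen rho A -> measurable A.
Proof. by move=> oA; rewrite rho_borel; exact: sub_sigma_algebra. Qed.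

Lemma rclosed_measurable A : rclosed rho A -> measurable A.
Proof. by move=> /ropen_measurable /measurableC; rewrite setCK. Qed.

Lemma rball_measurable x (r : R) : measurable (rball rho x r).
Proof. exact/ropen_measurable/ropen_rball. Qed.

(** The points at distance at least [n.+1%:R^-1] from the complement of [U] form closed sets
    increasing to [U], and a finite measure is continuous from above along the differences. *)
Lemma open_inner_closed (nu : {finite_measure set X -> \bar R}) (U : set X)
    (e : R) : ropen rho U -> 0 < e ->
  exists F, [/\ rclosed rho F, F `<=` U & (nu (U `\` F) < e%:E)%E].
Proof.
move=> oU e0.
pose F n := [set x | forall y, ~ U y -> n.+1%:R^-1 <= rho x y].
have cF n : rclosed rho (F n).
  move=> x /= /existsNP[y /not_implyP[Uy /negP]]; rewrite -ltNge => xy.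
  exists (n.+1%:R^-1 - rho x y); split; first by rewrite subr_gt0.
  move=> z xz /(_ y Uy); apply/negP; rewrite -ltNge.
  apply: le_lt_trans (rhoD z x y) _.
  by rewrite rhoC -ltrBrDr; exact: xz.
have FU n : F n `<=` U.
  move=> x Fx; apply: contrapT => /Fx; apply/negP.
  by rewrite rhoxx -ltNge invr_gt0.
have mF n : measurable (F n) by exact: rclosed_measurable.
have mU := ropen_measurable oU.
have capF : \bigcap_n (U `\` F n) = set0.
  apply/seteqP; split => // x UF.
  have [r [r0 rU]] := oU _ (UF 0%N I).1.
  have [n /ltW nr] : exists n, n.+1%:R^-1 < r.
    by exists (Num.truncn r^-1); rewrite invf_plt ?posrE// Num.Theory.truncnS_gt.
  case: (UF n I) => _; apply => y Uy; rewrite leNgt; apply/negP => xy.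
  by apply: Uy; apply: rU; rewrite /rball /=; exact: lt_le_trans nr.
have := @nonincreasing_cvg_mu _ _ _ nu (fun n => U `\` F n).
rewrite capF measure0 => cv.
have mD n : measurable (U `\` F n) by exact: measurableD.
have {cv} : (nu \o (fun n => U `\` F n)) @ \oo --> 0%E.
  apply: cv => //.
  - by have := fin_num_measure nu _ (mD 0%N); rewrite ge0_fin_numE.
  - move=> m n mn; apply/subsetPset => x [Ux Fx]; split => // Fmx; apply: Fx.
    move=> y /Fmx; apply: le_trans.
    by rewrite lef_pV2 ?posrE// ler_nat.
have : nbhs 0%E [set x : \bar R | (x < e%:E)%E] 
  by apply: open_nbhs_nbhs; split; [exact: open_ereal_lt_ereal|rewrite /= lte_fin].
move=> /[swap] /[apply] -[n _ /(_ n (leqnn n)) /= h].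
by exists (F n).
Qed.

(** The sets with such approximations form a sigma-algebra that contains the open sets. *)
Lemma closed_open_regularity (nu : {finite_measure set X -> \bar R}) (E : set X) :
  measurable E -> forall e : R, 0 < e ->
  exists F V, [/\ rclosed rho F, ropen rho V, F `<=` E, E `<=` V &
    (nu (V `\` F) < e%:E)%E].
Proof.
rewrite {1}rho_borel.
pose G (E : set X) := forall e : R, 0 < e ->
  exists F V, [/\ rclosed rho F, ropen rho V, F `<=` E, E `<=` V &
    (nu (V `\` F) < e%:E)%E].
suff : <<s ropen rho >> `<=` G by exact.
apply: smallest_sub => [|U oU e e0]; last first.
  by have [F [? ? ?]] := open_inner_closed nu oU e0; exists F, U; split.
split=> [e e0|A GA e e0|A GA e e0].
- exists set0, set0; split => //; first by move=> x _; exists 1; split => // y _ [].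
  by rewrite setD0 measure0 lte_fin.
- have [F [V [cF oO FA AO nuFO]]] := GA e e0; exists (~` V), (~` F).
  rewrite setTD; split => //; first by rewrite /rclosed setCK.
  + exact: subsetC.
  + exact: subsetC.
  + by rewrite setDE setCK setIC -setDE.
- have e2 n : 0 < (e / 2) / (2 ^ n.+1)%:R by rewrite !divr_gt0// ltr0n expn_gt0.
  have /choice[FO hFO] : forall n, exists FO : set X * set X,
      [/\ rclosed rho FO.1, ropen rho FO.2, FO.1 `<=` A n, A n `<=` FO.2 &
       (nu (FO.2 `\` FO.1) < ((e / 2) / (2 ^ n.+1)%:R)%:E)%E].
    by move=> n; have [F [V h]] := GA n _ (e2 n); exists (F, V).
  (* A countable union of closed sets need not be closed, so the inner sets are the finite unions
     [P n]. The differences with [V] decrease to a set of mass at most [e / 2], hence one of them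
     has mass below [e]. *)
  pose V := \bigcup_n (FO n).2.
  pose P n := \bigcup_(i < n.+1) (FO i).1.
  have mO1 n : measurable (FO n).2.
    by case: (hFO n) => _ /ropen_measurable.
  have mF1 n : measurable (FO n).1.
    by case: (hFO n) => /rclosed_measurable.
  have oO : ropen rho V by apply: ropen_bigcup => n; case: (hFO n).
  have mO : measurable V by exact: ropen_measurable.
  have cP n : rclosed rho (P n).
    rewrite /P; elim: n => [|n ih].
      by rewrite bigcup_mkord big_ord_recl big_ord0 setU0; case: (hFO 0%N).
    rewrite bigcup_mkord big_ord_recr /= -(bigcup_mkord n.+1 (fun i => (FO i).1)).
    by apply: rclosedU => //; case: (hFO n.+1).
  have mP n : measurable (P n) by exact: rclosed_measurable.
  have PA n : P n `<=` \bigcup_n A n.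
    by move=> x [i /= _ Fx]; exists i => //; case: (hFO i) => _ _ + _ _; exact.
  have mD n : measurable (V `\` P n) by exact: measurableD.
  have cap_small : (nu (\bigcap_n (V `\` P n)) <= (e / 2)%:E)%E.
    have mcap : measurable (\bigcap_n (V `\` P n)) by exact: bigcapT_measurable.
    apply: le_trans (@measure_sigma_subadditive _ _ _ nu _
      (fun n => (FO n).2 `\` (FO n).1) _ mcap _) _.
    - by move=> n; exact: measurableD.
    - move=> x h; have [n _ On] := (h 0%N I).1; exists n => //; split => // Fn.
      by apply: (h n I).2; exists n => /=.
    apply: le_trans (epsilon_trick0 xpredT _); last by rewrite divr_ge0// ltW.
    by apply: lee_nneseries => // n _; case: (hFO n) => _ _ _ _ /ltW.
  have cv : (nu \o (fun n => V `\` P n)) @ \oo --> nu (\bigcap_n (V `\` P n)).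
    apply: nonincreasing_cvg_mu => //.
    + by have := fin_num_measure nu _ (mD 0%N); rewrite ge0_fin_numE.
    + exact: bigcapT_measurable.
    + move=> m n mn; apply/subsetPset => x [Ox Px]; split => // -[i /= im Fx].
      by apply: Px; exists i => //=; exact: leq_trans im _.
  have : nbhs (nu (\bigcap_n (V `\` P n))) [set x : \bar R | (x < e%:E)%E].
    apply: open_nbhs_nbhs; split; first exact: open_ereal_lt_ereal.
    apply: le_lt_trans cap_small _.
    by rewrite lte_fin ltr_pdivrMr// ltr_pMr// ltr1n.
  move=> /cv[n _ /(_ n (leqnn n)) /= h].
  exists (P n), V; split => //.
  by move=> x [i _ Ax]; exists i => //; case: (hFO i) => _ _ _ + _; exact.
Qed.

End metric_borel.

(** * The kernel *)

Section green_kernel.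
Context {R : realType} {d : measure_display} {X : measurableType d}.
Variables (rho : X -> X -> R) (G : X -> X -> \bar R) (g : R -> \bar R).
Variables (c cD M0 alpha0 : R).
Hypothesis rho_metric : is_metric rho.
Hypothesis Gker : Gkernel G.
Hypothesis G2H : G2 rho G g c cD M0 alpha0.

Let c_ge1 : 1 <= c. Proof. by case: G2H. Qed.
Let cD_ge1 : 1 <= cD. Proof. by case: G2H => _ []. Qed.

(** Strict decrease gives [g r < g 0], so only [g 0] can be infinite and real arithmetic applies at
    positive radii. *)
Lemma G2_fineK (r : R) : 0 < r -> g r = (fine (g r))%:E.
Proof.
move=> r0; case: G2H => _ [_ [_ [_ [gpos [gdecr _]]]]].
have gr0 : (0 < g r)%E by apply: gpos; exact: ltW.
have : (g r < g 0)%E by apply: gdecr.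
by case: (g r) gr0 => //= _; case: (g 0).
Qed.

Lemma G2_fine_gt0 (r : R) : 0 < r -> 0 < fine (g r).
Proof.
move=> r0; rewrite -lte_fin -G2_fineK//.
by case: G2H => _ [_ [_ [_ [gpos _]]]]; apply: gpos; exact: ltW.
Qed.

Lemma G2_decr (s t : R) : 0 <= s -> s <= t -> (g t <= g s)%E.
Proof.
move=> s0; rewrite le_eqVlt => /predU1P[->//|st].
by case: G2H => _ [_ [_ [_ [_ [gdecr _]]]]]; exact/ltW/gdecr.
Qed.

Lemma G2_fine_decr (s t : R) : 0 < s -> s <= t -> fine (g t) <= fine (g s).
Proof.
move=> s0 st; rewrite -lee_fin -!G2_fineK//; last exact: lt_le_trans st.
by apply: G2_decr => //; exact: ltW.
Qed.

Lemma G2_fine_half (r : R) : 0 < r -> fine (g (r / 2)) <= cD * fine (g r).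
Proof.
move=> r0; rewrite -lee_fin EFinM -!G2_fineK ?divr_gt0//.
by case: G2H => _ [_ [_ [_ [_ [_ [_ [h _]]]]]]]; exact: h.
Qed.

Lemma G2_fine_iter (n : nat) (r : R) : 0 < r ->
  M0 ^+ n * fine (g r) <= fine (g (alpha0 ^+ n * r)).
Proof.
case: G2H => _ [_ [M01 [/andP[a0 _] [_ [_ [_ [_ [h _]]]]]]]] r0.
elim: n => [|n ih]; first by rewrite !expr0 !mul1r.
rewrite !exprS -!mulrA.
apply: (@le_trans _ _ (M0 * fine (g (alpha0 ^+ n * r)))).
  by rewrite ler_wpM2l// (le_trans ler01).
have p : 0 < alpha0 ^+ n * r by rewrite mulr_gt0// exprn_gt0.
have q : 0 < alpha0 * (alpha0 ^+ n * r) by rewrite mulr_gt0.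
by rewrite -lee_fin EFinM -!G2_fineK//; exact: h.
Qed.

(** Each doubling of [t] costs a factor [cD <= 2 ^+ b], which the power absorbs. Once [r < 2 * t],
    the comparison of [r / 2] with [r] leaves the extra factor [cD]. *)
Lemma G2_fine_power (b : nat) (t r : R) : cD <= 2 ^+ b -> 0 < t -> t <= r ->
  fine (g t) <= cD * (r / t) ^+ b * fine (g r).
Proof.
move=> cDb t0 tr; have r0 : 0 < r by exact: lt_le_trans tr.
have [n] : exists n : nat, r <= 2 ^+ n * t.
  exists (Num.truncn (r / t)).+1; rewrite -ler_pdivrMr//.
  apply: le_trans (ltW (Num.Theory.truncnS_gt _)) _.
  by rewrite -natrX ler_nat ltnW// ltn_expl.
elim: n t t0 tr => [|n ih] t t0 tr rt.
  have -> : t = r by apply/eqP; rewrite eq_le tr /= -[t]mul1r -(expr0 2).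
  rewrite divff ?gt_eqF// expr1n mulr1 ler_peMl// ltW//; exact: G2_fine_gt0.
have [rt2|rt2] := ltP r (2 * t).
  apply: (@le_trans _ _ (fine (g (r / 2)))).
    by apply: G2_fine_decr; rewrite ?divr_gt0//; lra.
  apply: le_trans (G2_fine_half r0) _; rewrite ler_wpM2r//.
    by rewrite ltW// G2_fine_gt0.
  rewrite ler_peMr//; first exact: le_trans cD_ge1.
  by rewrite exprn_ege1// ler_pdivlMr// mul1r.
have t20 : 0 < 2 * t by rewrite mulr_gt0.
have := ih (2 * t) t20 rt2; rewrite mulrA -exprSr => /(_ rt) h.
have := G2_fine_half t20; rewrite mulrAC divff// mul1r => /le_trans; apply.
apply: (@le_trans _ _ (2 ^+ b * (cD * (r / (2 * t)) ^+ b * fine (g r)))).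
  apply: ler_pM => //; first exact: le_trans cD_ge1.
  by rewrite ltW// G2_fine_gt0.
rewrite le_eqVlt; apply/orP; left; apply/eqP.
rewrite mulrA [X in X * _]mulrCA -exprMn; congr (_ * _ ^+ _ * _).
by field; rewrite gt_eqF.
Qed.

Let rhoC x y : rho x y = rho y x. Proof. by case: rho_metric => _ [_ []]. Qed.
Let rho0 x y : 0 <= rho x y. Proof. by case: rho_metric. Qed.
Let G0 x y : (0 <= G x y)%E. Proof. by case: Gker => _ h; exact/ltW/h. Qed.
Let c0 : 0 < c. Proof. exact: lt_le_trans c_ge1. Qed.

Lemma measurable_Gsection x : measurable_fun setT (G x).
Proof.
by case: Gker => mG _; exact: (@measurable_fun_pair2 _ _ _ _ _ _ _ x mG).
Qed.

Lemma Gpot_ge0 (nu : {finite_measure set X -> \bar R}) y : (0 <= Gpot G nu y)%E.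
Proof. exact: integral_ge0. Qed.

Lemma G_quasisym x y : (G x y <= (c ^+ 2)%:E * G y x)%E.
Proof.
case: G2H => _ [_ [_ [_ [_ [_ [_ [_ [_ h]]]]]]]].
have [_ h1] := h x y; have [h2 _] := h y x.
apply: le_trans h1 _; rewrite rhoC expr2 EFinM -muleA lee_pmul2l//.
by rewrite -lee_pdivrMl.
Qed.

Lemma Gpot_ge (nu : {finite_measure set X -> \bar R}) (B : set X) x (t : R) :
  measurable B -> nu (~` B) = 0%E -> 0 < t -> (forall z, B z -> rho x z <= t) ->
  ((c^-1 * fine (g t))%:E * nu setT <= Gpot G nu x)%E.
Proof.
move=> mB nuB t0 Bt; rewrite -integral_cst//.
apply: (@lower_integral_ge_ae _ _ _ _ _ _ (~` B)) => //=.
- exact: measurableC.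
- by move=> _; rewrite lee_fin mulr_ge0// ?invr_ge0 ltW// G2_fine_gt0.
move=> z /contrapT Bz; case: G2H => _ [_ [_ [_ [_ [_ [_ [_ [_ h]]]]]]]].
apply: le_trans (h x z).1; rewrite EFinM -G2_fineK// lee_pmul2l ?lte_fin ?invr_gt0//.
by apply: G2_decr => //; exact: Bt.
Qed.

Lemma Gpot_le (nu : {finite_measure set X -> \bar R}) (B : set X) x (t : R) :
  measurable B -> nu (~` B) = 0%E -> 0 < t -> (forall z, B z -> t <= rho x z) ->
  (Gpot G nu x <= (c * fine (g t))%:E * nu setT)%E.
Proof.
move=> mB nuB t0 Bt; rewrite -integral_cst//.
apply: (@lower_integral_le_ae _ _ _ _ _ _ (~` B)) => //=.
- exact: measurableC.
- by move=> _; rewrite lee_fin mulr_ge0// ltW// G2_fine_gt0.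
move=> z /contrapT Bz; case: G2H => _ [_ [_ [_ [_ [_ [_ [_ [_ h]]]]]]]].
apply: le_trans (h x z).2 _; rewrite EFinM -G2_fineK// lee_pmul2l ?lte_fin//.
by apply: G2_decr; [exact: ltW|exact: Bt].
Qed.

(* Integrating [G nu >= 1] against [lam] and exchanging the integrals. *)
Lemma mass_le_of_Gpot (nu lam : {finite_measure set X -> \bar R}) (A : set X) :
  measurable A -> lam (~` A) = 0%E -> (forall y, (Gpot G lam y <= 1)%E) ->
  (forall y, A y -> (1 <= Gpot G nu y)%E) ->
  (lam setT <= (c ^+ 2)%:E * nu setT)%E.
Proof.
move=> mA lamA lam1 nu1.
rewrite -[lam setT]mul1e -integral_cst//.
apply: (@le_trans _ _ (\int[lam]_y Gpot G nu y)%E).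
  apply: (@lower_integral_ge_ae _ _ _ _ _ _ (~` A)) => //=.
  - exact: measurableC.
  - exact: Gpot_ge0.
  - by move=> x /contrapT /nu1.
case: (Gker) => mG _.
rewrite /Gpot (@fubini_tonelli _ _ _ _ _ lam nu (fun p => G p.1 p.2) mG)//=.
rewrite -integral_cst//; apply: lower_integral_le => z.
  exact: integral_ge0.
apply: (@le_trans _ _ (\int[lam]_y ((c ^+ 2)%:E * G z y))%E).
  by apply: lower_integral_le => // y; exact: G_quasisym.
rewrite ge0_integralZl//; last 2 first.
- exact: measurable_Gsection.
- by rewrite lee_fin exprn_ge0// ltW.
rewrite -[leRHS]mule1 lee_pmul2l ?lte_fin ?exprn_gt0//.
exact: lam1.
Qed.

End green_kernel.

(** * Hitting estimates *)

Section hitting.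
Context {R : realType} {d : measure_display} {X : measurableType d}.
Variables (rho : X -> X -> R) (X0 : set X).
Variable mu : set X -> X -> {finite_measure set X -> \bar R}.
Variables (G : X -> X -> \bar R) (g : R -> \bar R).
Variables (c1 c cD M0 alpha0 c2 : R).
Hypothesis rho_metric : is_metric rho.
Hypothesis rho_borel : borel_space rho.
Hypothesis muH : harmonic_family rho mu.
Hypothesis Gker : Gkernel G.
Hypothesis G1H : G1 rho X0 mu G c1.
Hypothesis G2H : G2 rho G g c cD M0 alpha0.
Hypothesis G3H : G3 rho X0 G g c2.

Let rhoC x y : rho x y = rho y x. Proof. by case: rho_metric => _ [_ []]. Qed.
Let rhoD x y z : rho x z <= rho x y + rho y z.
Proof. by case: rho_metric => _ [_ [_]]. Qed.

Lemma rclosure_sub_of_lt_R0 x (r : R) : (r%:E < R0 rho X0 x)%E ->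
  rclosure rho (rball rho x r) `<=` X0.
Proof.
move=> /ereal_sup_gt[_ [s [s0 sX] <-]]; rewrite lte_fin => rs.
by apply: subset_trans sX; apply: rclosureS; apply: le_rball; exact: ltW.
Qed.

Lemma le_R0 x (r : R) : 0 < r -> rclosure rho (rball rho x r) `<=` X0 ->
  (r%:E <= R0 rho X0 x)%E.
Proof. by move=> r0 rX; apply: ereal_sup_ubound; exists r. Qed.

Lemma normeps_in A y : rclosed rho A -> A y -> normeps mu A y = 1%E.
Proof.
move=> cA Ay; have [_ [_ [h _]]] := muH cA y.
by rewrite /normeps h ?diracT//; exact.
Qed.

(** The exit measure of [V] does not charge [V], so a majorant of [f] is needed only off [V] and off
    a null set. *)
Lemma tower_le (V : set X) (f : X -> \bar R) (phi : X -> \bar R) x v N :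
  ropen rho V -> (forall y, 0 <= f y)%E ->
  cintegral_is (mu V x) f v -> measurable_fun setT phi ->
  (forall y, 0 <= phi y)%E -> measurable N -> mu V x N = 0%E ->
  (forall y, ~ V y -> ~ N y -> (f y <= phi y)%E) ->
  (v <= \int[mu V x]_y phi y)%E.
Proof.
move=> oV f0 /(cintegral_isE f0) -> mphi phi0 mN N0 fphi.
have mV := ropen_measurable rho_borel oV.
apply: (@lower_integral_le_ae _ _ _ _ _ _ (V `|` N)) => //.
- exact: measurableU.
- apply/eqP; rewrite eq_le measure_ge0 andbT -[leRHS]adde0 -{2}N0.
  by have [<- _] := muH oV x; exact: measureU2.
- by move=> y /not_orP[]; exact: fphi.
Qed.

(** The tower property, applied at the exit from [U] without [A]: the exit point is either in [A],
    or outside [U], where the chance of still hitting [A] is at most [b]. *)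
Lemma normeps_le_hit (U A : set X) x (b : R) : ropen rho U -> rclosed rho A ->
  0 <= b -> (forall y, ~ U y -> (normeps mu A y <= b%:E)%E) ->
  (normeps mu A x <= mu (U `\` A) x A + b%:E)%E.
Proof.
move=> oU cA b0 hb.
have oV : ropen rho (U `\` A) by exact: ropenD.
have mA := rclosed_measurable rho_borel cA.
have tower : cintegral_is (mu (U `\` A) x) (normeps mu A) (normeps mu A x).
  by case: (muH cA x) => _ [_ [_ [_ h]]]; apply: h => // y [].
have -> : (mu (U `\` A) x A + b%:E = mu (U `\` A) x A + b%:E * 1)%E.
  by rewrite mule1.
apply: (@le_trans _ _ (\int[mu (U `\` A) x]_y ((\1_A y)%:E + b%:E))%E).
  apply: (tower_le (N := set0) oV _ tower) => //.
  - apply: emeasurable_funD => //; exact/measurable_EFinP.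
  - by move=> y; rewrite -EFinD lee_fin addr_ge0// indicE.
  - move=> y VNy _; have [Ay|Ay] := pselect (A y).
      by rewrite (normeps_in cA)// indicE mem_set// -EFinD lee_fin lerDl.
    rewrite indicE memNset// add0e; apply: hb => Uy; exact: VNy.
rewrite ge0_integralD//; last exact/measurable_EFinP.
rewrite integral_indic// setIT leeD2l//.
rewrite -[X in (X <= _)%E]/(\int[mu (U `\` A) x]_y (cst b%:E y))%E integral_cst//.
by rewrite lee_wpmul2l//; case: (muH oV x) => _ [].
Qed.

(* The constant [2 cD^2 c^2 c1^2] makes hitting [A] at all at least twice as
   likely as hitting [A] only after having left the large ball. *)
Lemma hitting_lower_bound (k : nat) x0 (r : R) (A : set X) x
    (lam : {finite_measure set X -> \bar R}) :
  2 * cD ^+ 2 * c ^+ 2 * c1 ^+ 2 <= M0 ^+ k -> alpha0 ^+ k < 1 / 4 ->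
  0 < r -> (r%:E < R0 rho X0 x0)%E ->
  rclosed rho A -> A `<=` rball rho x0 (alpha0 ^+ k * r) ->
  rball rho x0 (alpha0 ^+ k * r) x ->
  lam (~` A) = 0%E -> (forall y, (Gpot G lam y <= 1)%E) ->
  ((cD / c * fine (g r))%:E * lam setT <= mu (rball rho x0 r `\` A) x A)%E.
Proof.
move=> hM ak r0 rR cA AW Wx lamA lam1.
set W := rball rho x0 (alpha0 ^+ k * r) in AW Wx *.
case: (G2H) => c_ge1 [cD_ge1 [_ [/andP[a0 _] _]]].
case: G1H => c1_ge1 G1'.
have aM0 : 0 < alpha0 ^+ k by rewrite exprn_gt0.
have ar : alpha0 ^+ k * r < r / 4.
  by rewrite [ltRHS]mulrC ltr_pM2r// -[4^-1]mul1r.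
have ar0 : 0 < alpha0 ^+ k * r by rewrite mulr_gt0.
have mA := rclosed_measurable rho_borel cA.
have oW : ropen rho W by exact: ropen_rball.
have cW : rclosure rho W `<=` X0.
  apply: subset_trans (rclosure_sub_of_lt_R0 rR); apply: rclosureS.
  by apply: le_rball; lra.
(* (G1) compares [A] and [B] only up to an error, so the bound is proved up to an arbitrary
   [dlt]. *)
apply/lee_addgt0Pr => dlt dlt0.
have [B [cB [BW [_ [nu [nuB [nB nGA]]]]]]] := G1' W oW cW x Wx dlt dlt0 A cA AW.
have mB := rclosed_measurable rho_borel cB.
have g0 : 0 < fine (g r) by exact: (G2_fine_gt0 G2H).
(* Seen from [x], the carrier of [nu] is within [2 * (alpha0 ^+ k * r)]; seen from outside the large
   ball, it is at distance at least [r / 2]. By (G2) the values of [g] at these two radii have ratio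
   at least [M0 ^+ k / cD ^+ 2]. *)
have e1 : ((c^-1 * fine (g (2 * (alpha0 ^+ k * r))))%:E * nu setT <= Gpot G nu x)%E.
  apply: (Gpot_ge rho_metric Gker G2H mB) => //; first lra.
  move=> z /BW; move: Wx; rewrite /W /rball /= => xz zz.
  by have := rhoD x x0 z; rewrite (rhoC x x0); lra.
have e2 y : ~ rball rho x0 r y ->
    (normeps mu A y <= (c * fine (g (r / 2)))%:E * nu setT)%E.
  move=> yr; apply: le_trans (nGA y).1 _.
  apply: (Gpot_le Gker G2H mB) => //; first lra.
  move=> z /BW; move: yr; rewrite /W /rball /= => /negP; rewrite -leNgt => xy xz.
  by have := rhoD x0 z y; rewrite (rhoC z y); lra.
have e3 : (lam setT <= (c ^+ 2)%:E * nu setT)%E.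
  apply: (mass_le_of_Gpot rho_metric Gker G2H mA) => // y Ay.
  by rewrite -(normeps_in cA Ay); case: (nGA y).
have e4 : (Gpot G nu x <= c1%:E * normeps mu B x)%E by case: (nGA x).
have oV : ropen rho (rball rho x0 r `\` A).
  by apply: ropenD => //; exact: ropen_rball.
have fnu := fin_num_measure nu _ measurableT.
have flam := fin_num_measure lam _ measurableT.
have fA : normeps mu A x \is a fin_num by exact: fin_num_measure.
have fB : normeps mu B x \is a fin_num by exact: fin_num_measure.
have fm : mu (rball rho x0 r `\` A) x A \is a fin_num by exact: fin_num_measure.
have n0 : 0 <= fine (nu setT) by exact: fine_ge0.
have e5 : (normeps mu A x <= mu (rball rho x0 r `\` A) x A +
    (c * fine (g (r / 2)) * fine (nu setT))%:E)%E.
  apply: normeps_le_hit => //; first exact: ropen_rball.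
    rewrite mulr_ge0// mulr_ge0//; first exact: le_trans c_ge1.
    by rewrite ltW// (G2_fine_gt0 G2H) ?divr_gt0.
  by move=> y /e2; rewrite [in X in _ -> X]EFinM fineK.
have h1 := G2_fine_half G2H r0.
have h2 : M0 ^+ k * fine (g r) <= cD * fine (g (2 * (alpha0 ^+ k * r))).
  apply: le_trans (G2_fine_iter G2H k r0) _.
  have := @G2_fine_half _ _ _ _ _ _ _ _ _ _ G2H (2 * (alpha0 ^+ k * r)).
  by rewrite [2 * _]mulrC mulfK//; apply; rewrite mulr_gt0.
have {e1} e1 := le_trans e1 e4.
move: e1 e3 e5 nB {e2 e4 nGA}.
rewrite -(fineK fnu) -(fineK flam) -(fineK fA) -(fineK fB) -(fineK fm).
move: (fine (nu setT)) n0 => n n0.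
move: (fine (lam setT)) (fine (normeps mu A x)) (fine (normeps mu B x)).
move: (fine (mu (rball rho x0 r `\` A) x A)) => m l nA nB.
rewrite -!(EFinM, EFinB, EFinD) !lee_fin lte_fin.
move: (fine (g (2 * _))) (fine (g (r / 2))) h1 h2 => g2 gh h1 h2 e1 e3 e5 e6.
set gr := fine (g r) in g0 h1 h2 *.
have cp : 0 < c by lra.
have cDp : 0 < cD by lra.
have c1p : 0 < c1 by lra.
have cg : c * gh * n <= c * cD * gr * n.
  by rewrite -mulrA -[leRHS]mulrA -mulrA ler_pM2l// mulrA ler_wpM2r.
have a1 : M0 ^+ k * gr * n <= cD * c * c1 * nB.
  apply: le_trans (ler_wpM2r n0 h2) _.
  rewrite -!mulrA ler_pM2l//; rewrite -mulrA ler_pdivrMl// in e1.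
have a2 : 2 * cD ^+ 2 * c ^+ 2 * c1 ^+ 2 * gr * n <= M0 ^+ k * gr * n.
  by rewrite ler_wpM2r// ler_pM2r.
have a3 : cD * c * c1 * nB <= cD * c * c1 * (c1 * nA + dlt).
  by rewrite ler_pM2l ?mulr_gt0//; lra.
(* By [cg], one copy of [cD * c * gr * n] bounds the contribution of hitting [A] after leaving the
   large ball; the other copy remains as lower bound for [m + dlt], and [a5] compares it with the
   mass of [lam]. *)
have a4 : 2 * (cD * c * gr * n) <= nA + dlt.
  have P : 0 < cD * c * c1 ^+ 2 by rewrite !mulr_gt0// exprn_gt0.
  rewrite -(ler_pM2l P).
  apply: (@le_trans _ _ (cD * c * c1 * (c1 * nA + dlt))).
    apply: le_trans a3; apply: le_trans a1; apply: le_trans a2.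
    by rewrite le_eqVlt; apply/orP; left; apply/eqP; ring.
  have : cD * c * c1 * dlt <= cD * c * c1 ^+ 2 * dlt.
    by rewrite ler_pM2r// ler_pM2l ?mulr_gt0// expr2 ler_peMr// ltW.
  have -> : cD * c * c1 * (c1 * nA + dlt) =
      cD * c * c1 ^+ 2 * nA + cD * c * c1 * dlt by ring.
  by rewrite [in X in _ -> X]mulrDr lerD2l.
have a5 : cD / c * gr * l <= cD * c * gr * n.
  apply: (@le_trans _ _ (cD / c * gr * (c ^+ 2 * n))).
    by rewrite ler_pM2l// !mulr_gt0// invr_gt0.
  rewrite le_eqVlt; apply/orP; left; apply/eqP; field; lra.
rewrite (_ : c * cD * gr * n = cD * c * gr * n) in cg; last by ring.
apply: le_trans a5 _; move: cg e5 a4.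
by move: (cD * c * gr * n) (c * gh * n) => Q Q'; lra.
Qed.

(** Inner regularity supplies [F]; restricting [lam] to [F] can only lower the potential. *)
Lemma closed_restriction (lam : {finite_measure set X -> \bar R}) (E : set X)
    (e : R) : measurable E -> 0 < e ->
  exists F (lam' : {finite_measure set X -> \bar R}),
    [/\ rclosed rho F, F `<=` E, lam' (~` F) = 0%E,
      forall y, (Gpot G lam' y <= Gpot G lam y)%E &
      (lam E <= lam' setT + e%:E)%E].
Proof.
move=> mE e0.
have [F [V [cF oV FE EV small]]] :=
  closed_open_regularity rho_metric rho_borel lam mE e0.
have mF := rclosed_measurable rho_borel cF.
have mV := ropen_measurable rho_borel oV.
exists F, (mrestr lam mF); split => //.
- by rewrite /= /mrestr setICl measure0.
- move=> y; apply: ge0_le_measure_integral => //.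
  + by move=> S mS; rewrite /= /mrestr; exact: measureIl.
  + by move=> z; case: Gker => _ h; exact/ltW/h.
  + exact: (measurable_Gsection Gker).
- rewrite /= /mrestr setTI; apply: (@le_trans _ _ (lam F + lam (V `\` F))%E).
    apply: (@le_trans _ _ (lam (F `|` V `\` F))).
      apply: le_measure; rewrite ?inE//; first by apply: measurableU => //; exact: measurableD.
      by move=> x Ex; have [Fx|Fx] := pselect (F x); [left|right; split => //; exact: EV].
    by apply: measureU2 => //; exact: measurableD.
  by rewrite leeD2l// ltW.
Qed.

(** With [w] the bound of (G3), some admissible measure on the ball has mass above [3 / 4 * w]. One
    of the two level sets carries at least half of that, and a closed subset of it still carries
    [w / 4]. *)
Lemma capacity_dichotomy y (s t : R) (h : X -> R) : X0 y -> 0 < s ->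
  (s%:E < R0 rho X0 y)%E -> umeasurable_fun (R := R) h ->
  exists C (lam : {finite_measure set X -> \bar R}),
    [/\ rclosed rho C, C `<=` rball rho y s, lam (~` C) = 0%E,
      forall z, (Gpot G lam z <= 1)%E &
      (((4 * c2 * fine (g s))^-1)%:E <= lam setT)%E /\
      ((forall z, C z -> h z <= t) \/ (forall z, C z -> t < h z))].
Proof.
move=> y0 s0 sR uh; case: G3H => c2_ge1 /(_ y s y0 s0 sR) capw.
have gs0 := G2_fine_gt0 G2H s0.
set w := c2^-1 * (fine (g s))^-1 in capw.
have w0 : 0 < w by rewrite mulr_gt0// invr_gt0//; lra.
have -> : (4 * c2 * fine (g s))^-1 = w / 4.
  by rewrite /w; field; rewrite gt_eqF//= gt_eqF//; lra.
have /ereal_sup_gt[_ [lam [lamB lam1] <-] wlam] :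
    ((3 / 4 * w)%:E < cap G (rball rho y s))%E.
  by apply: lt_le_trans capw; rewrite lte_fin; lra.
have mb := rball_measurable rho_metric rho_borel y s.
(* [h] is only universally measurable: the Borel set [B1] and the complement of [B2] lie inside the
   two level sets and together miss only a [lam]-null set. *)
have [B1 [B2 [mB1 [mB2 [B1h [hB2 B0]]]]]] :=
  uh _ (measurable_itv `]-oo, t]) lam.
have split_ball E : measurable E -> lam E = lam (E `&` rball rho y s).
  move=> mE; apply/eqP; rewrite eq_le; apply/andP; split; last exact: measureIl.
  have mI : measurable (E `&` rball rho y s) by exact: measurableI.
  have mbC := measurableC mb.
  rewrite -[leRHS]adde0 -lamB.
  apply: (@le_trans _ _ (lam ((E `&` rball rho y s) `|` ~` rball rho y s))).
    apply: le_measure; rewrite ?inE//; first exact: measurableU.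
    move=> z Ez; have [bz|bz] := pselect (rball rho y s z); last by right.
    by left.
  exact: measureU2.
have mB2C := measurableC mB2.
have mU : measurable (B1 `|` ~` B2) by exact: measurableU.
have mD : measurable (B2 `\` B1) by exact: measurableD.
have tot : (lam setT <= lam B1 + lam (~` B2))%E.
  apply: (@le_trans _ _ (lam ((B1 `|` ~` B2) `|` (B2 `\` B1)))).
    apply: le_measure; rewrite ?inE//; first exact: measurableU.
    move=> z _; have [z1|z1] := pselect (B1 z); first by left; left.
    by have [z2|z2] := pselect (B2 z); [right|left; right].
  apply: (@le_trans _ _ (lam (B1 `|` ~` B2) + lam (B2 `\` B1))%E).
    exact: measureU2.
  by rewrite [X in (_ + X)%E]B0 adde0; exact: measureU2.
have f1 := fin_num_measure lam _ mB1.
have f2 := fin_num_measure lam _ mB2C.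
have key E : measurable E -> (((3 / 8) * w)%:E <= lam E)%E ->
    exists C (lam' : {finite_measure set X -> \bar R}),
    [/\ rclosed rho C, C `<=` rball rho y s, lam' (~` C) = 0%E,
      forall z, (Gpot G lam' z <= 1)%E &
      ((w / 4)%:E <= lam' setT)%E /\ C `<=` E].
  move=> mE; rewrite split_ball// => wE.
  have mI : measurable (E `&` rball rho y s) by exact: measurableI.
  have w8 : 0 < w / 8 by lra.
  have [F [lam' [cF FE lamF Glam lamT]]] := closed_restriction lam mI w8.
  exists F, lam'; split => //; first by move=> z /FE[].
    by move=> z; exact: le_trans (Glam z) (lam1 z).
  split; last by move=> z /FE[].
  have := le_trans wE lamT.
  have f' := fin_num_measure lam' _ measurableT.
  by rewrite -(fineK f') -EFinD !lee_fin; lra.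
have [le1|le1] := leP ((3 / 8) * w)%:E (lam B1).
  have [C [lam' [? ? ? ? [? CB]]]] := key _ mB1 le1.
  exists C, lam'; split => //; split => //; left => z /CB/B1h.
  by rewrite /= in_itv.
have /(key _ mB2C)[C [lam' [? ? ? ? [? CB]]]] : ((3 / 8 * w)%:E <= lam (~` B2))%E.
  move: le1 (lt_le_trans wlam tot).
  rewrite -(fineK f1) -(fineK f2) -EFinD !lte_fin lee_fin; lra.
exists C, lam'; split => //; split => //; right => z /CB zB2.
by rewrite ltNge; apply/negP => hz; apply: zB2; apply: hB2; rewrite /= in_itv.
Qed.

End hitting.

(** * Exit measures and harmonic functions *)

(** A simple function below the restriction of [f] to [D] has its positive level sets inside [D],
    where the measures compare; the value 0 contributes nothing. *)
Lemma le_integral_of_le_measure {d : measure_display} {T : measurableType d}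
    {R : realType} (m1 m2 : {measure set T -> \bar R}) (D : set T) (k : R)
    (f : T -> \bar R) : 0 <= k ->
  (forall E, measurable E -> E `<=` D -> (m1 E <= k%:E * m2 E)%E) ->
  (forall x, D x -> (0 <= f x)%E) ->
  (\int[m1]_(x in D) f x <= k%:E * \int[m2]_(x in D) f x)%E.
Proof.
move=> k0 m12 f0; rewrite !ge0_integralE//.
apply: ge_ereal_sup => _ [h /= hf <-].
apply: (@le_trans _ _ (k%:E * sintegral m2 h)%E); last first.
  by rewrite lee_wpmul2l//; apply: ereal_sup_ubound; exists h.
rewrite !sintegralE ge0_mule_fsumr; last first.
  move=> r; have [r0|r0] := leP 0 r; first by rewrite mule_ge0.
  by rewrite preimage_nnfun0// measure0 mule0.
apply: lee_fsum => // r [z _ hz].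
have : 0 <= h z by []; rewrite hz le_eqVlt => /predU1P[<-|r0].
  by rewrite !mul0e mule0.
rewrite muleCA; apply: lee_wpmul2l; first by rewrite lee_fin ltW.
apply: m12 => // x /= hx; apply: contrapT => Dx.
by move: (hf x); rewrite patchE memNset// hx lee_fin leNgt r0.
Qed.

Section exit_measures.
Context {R : realType} {d : measure_display} {X : measurableType d}.
Variables (rho : X -> X -> R).
Variable mu : set X -> X -> {finite_measure set X -> \bar R}.
Hypothesis rho_metric : is_metric rho.
Hypothesis rho_borel : borel_space rho.
Hypothesis muH : harmonic_family rho mu.

(** At points of [E], which lie outside [U], the exit measure of [U] is Dirac; so the integrand of
    the tower formula is at least the indicator of [E]. *)
Lemma exit_domination (U V : set X) x (E : set X) : ropen rho U -> ropen rho V ->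
  V `<=` U -> measurable E -> E `<=` ~` U -> (mu V x E <= mu U x E)%E.
Proof.
move=> oU oV VU mE EU; have [_ [_ [_ [_ tower]]]] := muH oU x.
rewrite (cintegral_isE _ (tower V oV VU E mE))//.
have -> : (mu V x E = \int[mu V x]_y (\1_E y)%:E)%E.
  by rewrite integral_indic// setIT.
apply: lower_integral_le => z; first by rewrite lee_fin indicE.
rewrite indicE; have [Ez|Ez] := pselect (E z); last first.
  by rewrite memNset//; exact: measure_ge0.
have [_ [_ [dir _]]] := muH oU z.
by rewrite mem_set// dir// ?diracE ?mem_set//; exact: EU.
Qed.

Lemma exit_integral_tower (U V : set X) (f : {nnsfun X >-> R}) x :
  ropen rho U -> ropen rho V -> V `<=` U ->
  cintegral_is (mu V x) (fun z => \int[mu U z]_y (f y)%:E)%E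
    (\int[mu U x]_y (f y)%:E)%E.
Proof.
move=> oU oV VU.
(* Values of [f] are nonnegative, but the index [a] of the sum ranges over all reals; [|a|] makes
   every summand nonnegative, and a negative [a] has empty preimage. *)
have E z : (\int[mu U z]_y (f y)%:E = \sum_(a <- finmap.enum_fset (fset_set (range f)))
    `|a|%:E * mu U z (f @^-1` [set a]))%E.
  rewrite integralT_nnsfun sintegralE fsbig_finite//=; apply: eq_bigr => a _.
  have [a0|a0] := leP 0 a; first by rewrite ger0_norm.
  by rewrite preimage_nnfun0// measure0 !mule0.
under eq_fun do rewrite E; rewrite E.
apply: cintegral_is_sum => [a z|a]; first by rewrite mule_ge0.
apply: cintegral_isZ => //.
by case: (muH oU x) => _ [_ [_ [_ h]]]; exact: h.
Qed.

(** Exit measures have mass at most 1, so the bound is uniform in the point; it makes the weighted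
    supremum used later finite. *)
Lemma exit_integral_bounded (U : set X) (f : {nnsfun X >-> R}) : ropen rho U ->
  exists b : R, forall x, (\int[mu U x]_y (f y)%:E <= b%:E)%E.
Proof.
move=> oU; exists (\sum_(a <- finmap.enum_fset (fset_set (range f))) `|a|) => x.
rewrite integralT_nnsfun sintegralE fsbig_finite//= -sumEFin.
apply: lee_sum => a _.
apply: (@le_trans _ _ (`|a|%:E * mu U x (f @^-1` [set a]))%E).
  by rewrite lee_wpmul2r// lee_fin ler_norm.
rewrite -[leRHS]mule1 lee_wpmul2l//.
apply: (@le_trans _ _ (mu U x setT)); last by case: (muH oU x) => _ [].
by apply: le_measure; rewrite ?inE.
Qed.

Lemma harmonic_integralE (U V : set X) (h : X -> R) x : harmonic_pos rho mu U h ->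
  ropen rho V -> rclosure rho V `<=` U -> V x ->
  (h x)%:E = (\int[mu V x]_y (h y)%:E)%E.
Proof.
move=> [[_ hh] h0] oV VU Vx; apply: cintegral_isE => [y|]; first by rewrite lee_fin.
exact/cintegrable_is_cintegral/hh.
Qed.

Lemma exit_integral_le_harmonic (U0 U : set X) (h : X -> R)
    (f : {nnsfun X >-> R}) x : harmonic_pos rho mu U0 h -> ropen rho U ->
  rclosure rho U `<=` U0 -> (forall y, f y <= h y) ->
  (\int[mu U x]_y (f y)%:E <= (h x)%:E)%E.
Proof.
move=> hh oU UU fh; have [Ux|Ux] := pselect (U x).
  rewrite (harmonic_integralE hh oU UU Ux); apply: lower_integral_le => y.
    by rewrite lee_fin.
  by rewrite lee_fin.
have [_ [_ [dir _]]] := muH oU x.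
rewrite (@eq_measure_integral _ _ _ _ \d_x); last by move=> E mE _; exact: dir.
rewrite integral_dirac//; last exact/measurable_EFinP.
by rewrite diracT mul1e lee_fin.
Qed.

(** The mean value of [h] is a lower integral, hence a supremum of exit integrals of simple
    functions; through it a bound for bounded minorants reaches [h]. *)
Lemma harmonic_le_of_exit_integral (U0 U : set X) (h : X -> R) x (b : R) :
  harmonic_pos rho mu U0 h -> ropen rho U -> rclosure rho U `<=` U0 -> U x ->
  (forall f : {nnsfun X >-> R}, (forall y, f y <= h y) ->
    (\int[mu U x]_y (f y)%:E <= b%:E)%E) -> h x <= b.
Proof.
move=> hh oU UU Ux hf; rewrite -lee_fin (harmonic_integralE hh oU UU Ux).
rewrite ge0_integralTE; last by move=> y; rewrite lee_fin; case: hh.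
apply: ge_ereal_sup => _ [f /= fh <-]; rewrite -integralT_nnsfun.
by apply: hf => y; rewrite -lee_fin.
Qed.

(** Markov's inequality for the exit measure, combined with the mean value property. *)
Lemma harmonic_ge_hit (U0 V C : set X) (h : X -> R) x (t : R) :
  harmonic_pos rho mu U0 h -> ropen rho V -> rclosure rho V `<=` U0 -> V x ->
  measurable C -> 0 <= t -> (forall z, C z -> t <= h z) ->
  (t%:E * mu V x C <= (h x)%:E)%E.
Proof.
move=> hh oV VU Vx mC t0 th; rewrite (harmonic_integralE hh oV VU Vx).
have -> : (t%:E * mu V x C = \int[mu V x]_y (t%:E * (\1_C y)%:E))%E.
  rewrite ge0_integralZl//; last exact/measurable_EFinP.
  by rewrite integral_indic// setIT.
apply: lower_integral_le => y; first by rewrite mule_ge0 ?lee_fin ?indicE.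
rewrite indicE; have [Cy|Cy] := pselect (C y).
  by rewrite mem_set// mule1 lee_fin th.
by rewrite memNset// mule0 lee_fin; case: hh.
Qed.

Variables (X0 : set X) (alpha2 cJ : R).
Hypothesis HJH : HJ rho X0 mu alpha2 cJ.

Let a2_gt0 : 0 < alpha2. Proof. by case: HJH => /andP[]. Qed.
Let a2_lt1 : alpha2 < 1. Proof. by case: HJH => /andP[]. Qed.
Let cJ_ge1 : 1 <= cJ. Proof. by case: HJH => _ []. Qed.

(** [phi] is a Borel version of [h] for the exit measure at [y']. By (HJ), the far part of its
    exceptional set is also null for the exit measure at [y], and the far integral is at most [cJ]
    times the one at [y']. *)
Lemma jump_majorant (U0 C : set X) (h : X -> R) y y' (r : R) :
  harmonic_pos rho mu U0 h -> X0 y -> 0 < r ->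
  (r%:E < alpha2%:E * R0 rho X0 y)%E -> rclosure rho (rball rho y r) `<=` U0 ->
  rclosed rho C -> rball rho y (alpha2 ^+ 2 * r) y' ->
  exists (phi : X -> \bar R) (N : set X),
    [/\ measurable_fun setT phi, forall z, (0 <= phi z)%E, measurable N,
      mu (rball rho y (alpha2 * r) `\` C) y N = 0%E &
      (forall z, ~ rball rho y r z -> ~ N z -> (h z)%:E <= phi z)%E /\
      (\int[mu (rball rho y (alpha2 * r) `\` C) y]_(z in ~` rball rho y r) phi z
        <= (cJ * h y')%:E)%E].
Proof.
move=> hh y0 r0 rR cl cC yy'.
have ob s : ropen rho (rball rho y s) by exact: ropen_rball.
have mb s : measurable (rball rho y s) by exact: rball_measurable.
have mfar := measurableC (mb r).
have a2r : alpha2 * r <= r by rewrite ger_pMl// ltW.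
have yr : rball rho y r y'.
  by apply: le_rball yy'; rewrite ger_pMl// expr_le1// ltW.
have h0 z : (0 <= (h z)%:E)%E by rewrite lee_fin; case: hh.
have /(cintegral_is_ge0_version h0)[phi [N [mphi phi0 mN N0 [hphi intphi]]]] :
    cintegral_is (mu (rball rho y r) y') (fun z => (h z)%:E) (h y')%:E.
  by apply: cintegrable_is_cintegral; case: hh => -[_ hh'] _; exact: hh'.
have dom E : measurable E -> E `<=` ~` rball rho y r ->
    (mu (rball rho y (alpha2 * r) `\` C) y E <= cJ%:E * mu (rball rho y r) y' E)%E.
  move=> mE Efar; apply: (@le_trans _ _ (mu (rball rho y (alpha2 * r)) y E)).
    apply: exit_domination => //; first exact: ropenD.
    by apply: subset_trans Efar _; apply: subsetC; exact: le_rball.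
  by case: HJH => _ [_ hj]; exact: hj.
exists phi, (N `&` ~` rball rho y r); split => //.
- exact: measurableI.
- apply/eqP; rewrite eq_le measure_ge0 andbT.
  apply: le_trans (dom _ _ _) _; [exact: measurableI|by move=> z []|].
  rewrite [X in (_ * X)%E](_ : _ = 0%E) ?mule0//.
  apply/eqP; rewrite eq_le measure_ge0 andbT -[leRHS]N0.
  exact: measureIl.
- split=> [z zr Nz|].
    by rewrite hphi// => Nz'; apply: Nz.
  apply: (@le_trans _ _
    (cJ%:E * \int[mu (rball rho y r) y']_(z in ~` rball rho y r) phi z)%E).
    by apply: le_integral_of_le_measure => //; exact: le_trans cJ_ge1.
  rewrite EFinM lee_wpmul2l ?lee_fin//; first exact: le_trans cJ_ge1.
  by rewrite -intphi; apply: ge0_subset_integral => //; exact: measurable_funTS.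
Qed.

(* The exit measure of [rball y (alpha2 * r) `\` C] splits into its parts on [C],
   on the rest of [rball y r], and on the complement, which (HJ) controls. *)
Lemma growth_step (U0 C : set X) (h v : X -> R) y y' (r p t S : R) :
  harmonic_pos rho mu U0 h -> X0 y -> 0 < r ->
  (r%:E < alpha2%:E * R0 rho X0 y)%E -> rclosure rho (rball rho y r) `<=` U0 ->
  rclosed rho C -> C `<=` rball rho y (alpha2 ^+ 2 * r) -> C y' ->
  (forall z, C z -> h z <= t) -> (forall z, 0 <= v z) -> (forall z, v z <= h z) ->
  (forall z, rball rho y r z -> v z <= S) ->
  cintegral_is (mu (rball rho y (alpha2 * r) `\` C) y)
    (fun z => (v z)%:E) (v y)%:E ->
  (p%:E <= mu (rball rho y (alpha2 * r) `\` C) y C)%E ->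
  v y <= t + S * (1 - p) + cJ * t.
Proof.
move=> hh y0 r0 rR cl cC CB Cy' ht v0 vh vS tower pC.
set V := _ `\` C in tower pC *.
have oV : ropen rho V by apply: ropenD => //; exact: ropen_rball.
have mb : measurable (rball rho y r) by exact: rball_measurable.
have mC := rclosed_measurable rho_borel cC.
have Cb : C `<=` rball rho y r.
  by apply: subset_trans CB _; apply: le_rball; rewrite ger_pMl// expr_le1// ltW.
have t0 : 0 <= t by apply: le_trans (ht _ Cy'); exact: le_trans (vh y').
have S0 : 0 <= S by apply: le_trans (vS y' _); [exact: v0|exact: Cb].
have [phi [N [mphi phi0 mN N0 [hphi intphi]]]] :=
  jump_majorant hh y0 r0 rR cl cC (CB _ Cy').
have mbC : measurable (rball rho y r `\` C) by exact: measurableD.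
have mfar := measurableC mb.
pose f1 z : \bar R := (t%:E * (\1_C z)%:E)%E.
pose f2 z : \bar R := (S%:E * (\1_(rball rho y r `\` C) z)%:E)%E.
pose f3 := phi \_ (~` rball rho y r).
have f10 z : (0 <= f1 z)%E by rewrite mule_ge0 ?lee_fin ?indicE.
have f20 z : (0 <= f2 z)%E by rewrite mule_ge0 ?lee_fin ?indicE.
have f30 z : (0 <= f3 z)%E by rewrite /f3 patchE; case: ifP.
have mf1 : measurable_fun setT f1.
  by apply: measurable_funeM; exact/measurable_EFinP.
have mf2 : measurable_fun setT f2.
  by apply: measurable_funeM; exact/measurable_EFinP.
have mf3 : measurable_fun setT f3.
  by apply: (measurable_restrictT phi mfar).1; exact: measurable_funTS.
have : ((v y)%:E <= \int[mu V y]_z (f1 z + (f2 z + f3 z)))%E.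
  apply: (tower_le rho_borel muH oV _ tower _ _ mN N0).
  - by move=> z; rewrite lee_fin.
  - by do 2 (apply: emeasurable_funD => //).
  - by move=> z; rewrite !adde_ge0.
  - move=> z _ Nz; have [Cz|Cz] := pselect (C z).
      apply: (@le_trans _ _ (f1 z)); last by rewrite leeDl// adde_ge0.
      rewrite /f1 indicE mem_set// mule1 lee_fin.
      exact: le_trans (vh z) (ht z Cz).
    have [bz|bz] := pselect (rball rho y r z).
      apply: (@le_trans _ _ (f2 z)); last first.
        by rewrite (le_trans _ (leeDr _ _))// leeDl.
      by rewrite /f2 indicE mem_set// mule1 lee_fin vS.
    apply: (@le_trans _ _ (f3 z)); last first.
      by rewrite (le_trans _ (leeDr _ _))// leeDr.
    rewrite /f3 patchE mem_set//; apply: le_trans (hphi _ bz Nz).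
    by rewrite lee_fin.
rewrite ge0_integralD//; last 2 first.
- by move=> z _; rewrite adde_ge0.
- exact: emeasurable_funD.
rewrite ge0_integralD// /f1 /f2 !ge0_integralZl//; last 2 first.
- exact/measurable_EFinP.
- exact/measurable_EFinP.
rewrite !integral_indic// !setIT /f3 -integral_mkcond.
have [_ [V1 _]] := muH oV y.
have fC := fin_num_measure (mu V y) _ mC.
have fb := fin_num_measure (mu V y) _ mbC.
(* Total mass at most 1 turns the lower bound [p] on [C] into the upper bound [1 - p] on the rest of
   the ball. *)
have sum1 : (mu V y C + mu V y (rball rho y r `\` C) <= 1)%E.
  rewrite -measureU//; last by rewrite setDE setICA setICr setI0.
  by apply: le_trans V1; apply: le_measure; rewrite ?inE//; exact: measurableU.
move=> main.
have {main intphi} : ((v y)%:E <= t%:E * mu V y C +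
    (S%:E * mu V y (rball rho y r `\` C) + (cJ * h y')%:E))%E.
  exact: le_trans main (leeD2l _ (leeD2l _ intphi)).
move: sum1 pC; rewrite -(fineK fC) -(fineK fb).
have : 0 <= fine (mu V y C) by exact: fine_ge0.
have : 0 <= fine (mu V y (rball rho y r `\` C)) by exact: fine_ge0.
move: (fine (mu V y C)) (fine (mu V y (rball rho y r `\` C))) => m1 m2 m20 m10.
rewrite -!EFinM -!EFinD !lee_fin => m12 pm1 main.
have e1 : t * m1 <= t by rewrite ler_piMr//; lra.
have e2 : S * m2 <= S * (1 - p) by rewrite ler_wpM2l//; lra.
have e3 : cJ * h y' <= cJ * t.
  by rewrite ler_wpM2l//; [exact: le_trans cJ_ge1|exact: ht].
move: main e1 e2 e3.
move: (t * m1) (S * m2) (S * (1 - p)) (cJ * h y') (cJ * t) => *; lra.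
Qed.

End exit_measures.

(** * The Harnack inequality *)

Lemma bernoulli_1B {R : realDomainType} (n : nat) (x : R) : 0 <= x -> x <= 1 ->
  1 - n%:R * x <= (1 - x) ^+ n.
Proof.
move=> x0 x1; elim: n => [|n ih]; first by rewrite mul0r subr0 expr0.
rewrite exprS -natr1; apply: le_trans (ler_wpM2l _ ih); last lra.
have : 0 <= n%:R * x ^+ 2 by rewrite mulr_ge0// sqr_ge0.
have -> : (1 - x) * (1 - n%:R * x) = 1 - (n%:R + 1) * x + n%:R * x ^+ 2 by ring.
by rewrite lerDl.
Qed.

(** Turns the hitting bound, with the capacity bound of the dichotomy inserted, into a power of the
    ratio of radii. The factor [cD] cancels the one from the power bound on [g]. *)
Lemma hitting_ratio {R : realType} {d : measure_display} {X : measurableType d}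
    (rho : X -> X -> R) (G : X -> X -> \bar R) (g : R -> \bar R)
    (c cD M0 alpha0 c2 : R) (b : nat) (s r : R) :
  G2 rho G g c cD M0 alpha0 -> 0 < c2 -> cD <= 2 ^+ b -> 0 < s -> s <= r ->
  (s / r) ^+ b / (4 * c * c2) <= cD / c * fine (g r) * (4 * c2 * fine (g s))^-1.
Proof.
move=> G2H c2_gt0 cDb s0 sr.
have c_gt0 : 0 < c by case: G2H => /(lt_le_trans ltr01).
have cD_gt0 : 0 < cD by case: G2H => _ [/(lt_le_trans ltr01)].
 have r0 : 0 < r by exact: lt_le_trans sr.
have gs := G2_fine_gt0 G2H s0; have gr := G2_fine_gt0 G2H r0.
rewrite ler_pdivrMr ?mulr_gt0// mulrAC ler_pdivlMr ?mulr_gt0//.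
have sr0 : 0 < (s / r) ^+ b by rewrite exprn_gt0// divr_gt0.
apply: (@le_trans _ _ ((s / r) ^+ b * (4 * c2) * (cD * (r / s) ^+ b * fine (g r)))).
  by rewrite [leLHS]mulrA ler_pM2l ?mulr_gt0//; exact: (G2_fine_power G2H).
have -> : (r / s) ^+ b = ((s / r) ^+ b)^-1 by rewrite -exprVn invf_div.
rewrite le_eqVlt; apply/orP; left; apply/eqP; field.
by rewrite !gt_eqF.
Qed.

(* A near maximiser [y] of [v z * (D z / r0) ^+ b], with [D z] the distance of
   [z] to the complement of the ball, would contradict [growth_step]: the weight
   is almost constant on [rball y (theta * D y)], so [v] barely exceeds [v y] there. *)
Lemma weighted_sup_bound {R : realType} {d : measure_display}
    {X : measurableType d} (rho : X -> X -> R) (X0 : set X)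
    (mu : set X -> X -> {finite_measure set X -> \bar R})
    (G : X -> X -> \bar R) (g : R -> \bar R)
    (c1 c cD M0 alpha0 c2 alpha2 cJ : R) (k b : nat) (a p zeta theta : R) x0 (Rr : R)
    (h v : X -> R) (m : R) z0 :
  is_metric rho -> borel_space rho -> harmonic_family rho mu -> Gkernel G ->
  G1 rho X0 mu G c1 -> G2 rho G g c cD M0 alpha0 -> G3 rho X0 G g c2 ->
  HJ rho X0 mu alpha2 cJ ->
  2 * cD ^+ 2 * c ^+ 2 * c1 ^+ 2 <= M0 ^+ k -> alpha0 ^+ k < 1 / 4 ->
  cD <= 2 ^+ b -> 0 < a -> a <= alpha0 ^+ k -> a <= alpha2 ->
  p = a ^+ b / (4 * c * c2) -> p <= 1 / 4 -> zeta = p / (2 * (1 + cJ)) ->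
  0 < theta -> theta <= alpha2 -> theta <= 1 / 2 -> b%:R * theta <= p / 8 ->
  X0 x0 -> 0 < Rr -> (Rr%:E < R0 rho X0 x0)%E ->
  harmonic_pos rho mu (rball rho x0 Rr) h ->
  (forall z, 0 <= v z) -> (forall z, v z <= h z) -> (forall z, v z <= m) ->
  (forall V y, ropen rho V -> V `<=` rball rho x0 (Rr / 2) ->
    cintegral_is (mu V y) (fun z => (v z)%:E) (v y)%:E) ->
  rball rho x0 (alpha0 ^+ k * (Rr / 2)) z0 ->
  forall y, rball rho x0 (alpha0 ^+ k * (Rr / 2)) y ->
  v y * ((alpha0 ^+ k * (Rr / 2) - rho x0 y) / (Rr / 2)) ^+ b <=
  8 * c * c2 / (zeta * (a * alpha2 * theta) ^+ b) * h z0.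
Proof.
move=> rho_metric rho_borel muH Gker G1H G2H G3H HJH.
have [rho0 [_ [_ rhoD]]] := rho_metric.
have c_gt0 : 0 < c by case: G2H => /(lt_le_trans ltr01).
have cD_gt0 : 0 < cD by case: G2H => _ [/(lt_le_trans ltr01)].
have c2_gt0 : 0 < c2 by case: G3H => /(lt_le_trans ltr01).
move=> hM ak cDb a0 aaM aa2 pE p4 zE th0 tha2 th2 bth x0X Rr0 RrR hh v0 vh vm tw.
case: (HJH) => /andP[a20 a21] [cJ1 _].
set r0 := Rr / 2; set W := rball rho x0 _; set K1 := 8 * c * c2 / _.
move=> Wz0 y1 Wy1.
have r00 : 0 < r0 by rewrite divr_gt0.
have r0Rr : r0 < Rr by rewrite /r0; move: Rr0; clear; lra.
have r0R : (r0%:E < R0 rho X0 x0)%E.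
  by apply: lt_trans RrR; rewrite lte_fin.
have aM0 : 0 < alpha0 ^+ k by exact: lt_le_trans aaM.
have aMr : alpha0 ^+ k * r0 < r0 / 4.
  by rewrite [ltRHS]mulrC ltr_pM2r// -[4^-1]mul1r.
have p0 : 0 < p by rewrite pE divr_gt0 ?exprn_gt0// !mulr_gt0.
have z_gt0 : 0 < zeta by rewrite zE divr_gt0// mulr_gt0// ltr_wpDr// (le_trans ler01).
have zEp : (1 + cJ) * zeta = p / 2 by rewrite zE; field; rewrite gt_eqF// ltr_wpDr// (le_trans ler01).
have aat0 : 0 < (a * alpha2 * theta) ^+ b by rewrite exprn_gt0// !mulr_gt0.
have K10 : 0 < K1 by rewrite /K1 divr_gt0// !mulr_gt0.
pose D y := alpha0 ^+ k * r0 - rho x0 y.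
pose F y := v y * (D y / r0) ^+ b.
rewrite -[leLHS]/(F y1) leNgt; apply/negP => Fy1.
have DW y : W y -> 0 < D y by rewrite /W /rball /D /= -subr_gt0.
have D1 y : W y -> 0 < D y / r0 <= 1.
  move=> Wy; rewrite divr_gt0 ?DW//= ler_pdivrMr// mul1r /D.
  by have := rho0 x0 y; move: aMr r00; clear; lra.
have Fv y : W y -> F y <= v y.
  move=> /D1/andP[q0 q1]; rewrite /F ler_piMr//.
  by rewrite exprn_ile1// ltW.
pose FW := [set F y | y in W].
(* The bound [m] makes the supremum finite and does not enter [K1]. *)
have supFW : has_sup FW.
  split; first by exists (F y1), y1.
  by exists m => _ [y Wy <-]; exact: le_trans (Fv _ Wy) (vm y).
set S := sup FW.
have FS y : W y -> F y <= S.
  by move=> Wy; apply: (ub_le_sup supFW.2); exists y.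
have hz0 : 0 <= h z0 by case: hh.
have S0 : K1 * h z0 < S by exact: lt_le_trans (FS _ Wy1).
have Sp : 0 < S by apply: le_lt_trans S0; rewrite mulr_ge0// ltW.
have e0 : 0 < p / 8 * S by rewrite mulr_gt0// divr_gt0.
have [_ [y Wy <-]] := sup_adherent e0 supFW; rewrite -/S => Fy.
have {}Fy : (1 - p / 8) * S < F y by rewrite mulrBl mul1r.
have Dy := DW y Wy; have /andP[q0 q1] := D1 y Wy.
set q := D y / r0 in q0 q1.
have qb0 : 0 < q ^+ b by rewrite exprn_gt0.
set L := v y.
have FE : F y = L * q ^+ b by [].
have Fyp : 0 < F y by apply: le_lt_trans Fy; rewrite mulr_ge0 ?ltW//; move: p4; clear; lra.
have L0 : 0 < L by exact: lt_le_trans Fyp (Fv y Wy).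
(* [theta <= 1 / 2] keeps this ball inside [W], and [theta <= alpha2] gives the radius condition of
   (HJ). *)
set r := theta * D y.
have rp : 0 < r by rewrite mulr_gt0.
have DyM : D y <= alpha0 ^+ k * r0 by rewrite /D gerDl oppr_le0.
have rD : r <= D y / 2 by rewrite /r mulrC ler_pM2l// -[2^-1]mul1r.
have rW : rball rho y r `<=` W.
  by apply: rball_subset => //; move: rD Dy; rewrite /D; clear; lra.
have xy : rho x0 y < r0 / 4 by apply: lt_trans aMr; exact: Wy.
have y0X : X0 y.
  apply: (rclosure_sub_of_lt_R0 r0R); apply: sub_rclosure => //.
  by rewrite /rball /=; move: xy r00; clear; lra.
have R0y : ((r0 / 2)%:E <= R0 rho X0 y)%E.
  apply: le_R0; first by rewrite divr_gt0.
  apply: subset_trans (rclosure_sub_of_lt_R0 r0R); apply: rclosureS.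
  by apply: rball_subset => //; move: xy r00; clear; lra.
have ltR0 t : t < r0 / 2 -> (t%:E < R0 rho X0 y)%E.
  by move=> tr; apply: lt_le_trans R0y; rewrite lte_fin.
have rR0 : (r%:E < alpha2%:E * R0 rho X0 y)%E.
  apply: (@lt_le_trans _ _ (alpha2%:E * (r0 / 2)%:E)%E).
    rewrite -EFinM lte_fin; apply: (@le_lt_trans _ _ (alpha2 * D y)).
      by rewrite /r ler_pM2r.
    by rewrite ltr_pM2l//; move: DyM aMr r00; clear; lra.
  by rewrite lee_pmul2l.
have aa21 : a * alpha2 <= 1 by rewrite mulr_ile1 ?ltW// (le_lt_trans aa2).
have rr0 : r < r0 / 2 by move: rD DyM aMr r00; clear; lra.
(* [a <= alpha0 ^+ k] puts the ball of radius [s] where the hitting estimate for radius [alpha2 * r]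
   applies; [a <= alpha2] puts it where (HJ) compares exit measures. *)
set s := a * alpha2 * r.
have sp : 0 < s by rewrite !mulr_gt0.
have sr : s <= r by rewrite /s ger_pMl.
have [_ uh] : True /\ umeasurable_fun (R := R) h by case: hh => -[].
have clr t : t < Rr -> rclosure rho (rball rho x0 t) `<=` rball rho x0 Rr.
  exact: rclosure_rball.
have [|C [lam [cC CB lamC lam1 [lamT hC]]]] :=
  @capacity_dichotomy _ _ _ _ _ _ _ _ _ _ _ _ rho_metric rho_borel Gker G2H G3H
    y s (zeta * L) h y0X sp _ uh.
  by apply: ltR0; exact: le_lt_trans sr rr0.
have mC := rclosed_measurable rho_borel cC.
have zL0 : 0 < zeta * L by rewrite mulr_gt0.
have gr00 := G2_fine_gt0 G2H r00.
have gs0 := G2_fine_gt0 G2H sp.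
(* First the case of large values on [C]. The chance of reaching [C] from [z0] is at least of order
   [(s / r0) ^+ b], which contains the weight [q ^+ b] of [y]; this is what lets the bound on [h z0]
   be matched with [F y]. *)
case: hC => hC; last first.
  have CW : C `<=` W.
    by apply: subset_trans rW; apply: subset_trans CB _; exact: le_rball.
  have hit := @hitting_lower_bound _ _ _ _ _ _ _ _ _ _ _ _ _ rho_metric rho_borel
    muH Gker G1H G2H k x0 r0 C z0 lam hM ak r00 r0R cC CW Wz0 lamC lam1.
  (* [K1] carries 8 instead of 4: the spare factor 2 pays for [y] being only a near maximiser. *)
  have Kbig : h z0 < zeta * (a * alpha2 * theta) ^+ b / (4 * c * c2) * F y.
    have K1E : K1^-1 * 2 = zeta * (a * alpha2 * theta) ^+ b / (4 * c * c2).
      by rewrite /K1; field; rewrite !gt_eqF.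
    rewrite -K1E -mulrA; rewrite mulrC -ltr_pdivlMr// mulrC in S0.
    apply: lt_trans S0 _; rewrite ltr_pM2l ?invr_gt0//.
    apply: (@lt_trans _ _ (2 * ((1 - p / 8) * S))); last by rewrite ltr_pM2l.
    rewrite mulrA ltr_pMl//; move: p4; clear; lra.
  (* This places [z0] outside [C], hence in the open set where the mean value property is
     applied. *)
  have Kz : h z0 < zeta * L.
    apply: lt_le_trans Kbig _; apply: (@le_trans _ _ (zeta * F y)).
      rewrite ler_pM2r// -mulrA ler_piMr//; first exact: ltW.
      rewrite ler_pdivrMr ?mulr_gt0// mul1r.
      apply: (@le_trans _ _ 1).
        rewrite exprn_ile1//; first by rewrite ltW// !mulr_gt0.
        by rewrite mulr_ile1// ?ltW ?mulr_gt0// (le_lt_trans tha2).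
      case: (G2H) (G3H) => c1' _ [c2' _].
      rewrite -mulrA (le_trans (_ : 1 <= 4))// ?ler1n// ler_peMr//.
      by rewrite mulr_ege1.
    by rewrite ler_pM2l// Fv.
  have Cz0 : ~ C z0 by move=> /hC; apply/negP; rewrite -leNgt ltW.
  have Uz0 : (rball rho x0 r0 `\` C) z0.
    split => //; apply: lt_trans Wz0 _; move: aMr r00; clear; lra.
  have oU : ropen rho (rball rho x0 r0 `\` C).
    by apply: ropenD => //; exact: ropen_rball.
  have clU : rclosure rho (rball rho x0 r0 `\` C) `<=` rball rho x0 Rr.
    apply: subset_trans (clr r0 r0Rr).
    by apply: rclosureS => z [].
  have hge := harmonic_ge_hit hh oU clU Uz0 mC (ltW zL0) (fun z Cz => ltW (hC z Cz)).
  have : ((zeta * L * (cD / c * fine (g r0) * (4 * c2 * fine (g s))^-1))%:E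
      <= (h z0)%:E)%E.
    apply: le_trans hge; rewrite EFinM lee_pmul2l//; apply: le_trans hit.
    by rewrite EFinM lee_pmul2l// lte_fin !mulr_gt0// invr_gt0.
  rewrite lee_fin => le1.
  have sr0 : s <= r0 by move: sr rr0 r00; clear; lra.
  have ratio := hitting_ratio G2H c2_gt0 cDb sp sr0.
  have : zeta * L * ((s / r0) ^+ b / (4 * c * c2)) <= h z0.
    by apply: le_trans le1; rewrite ler_pM2l.
  have -> : s / r0 = a * alpha2 * theta * q by rewrite /s /r /q !mulrA.
  rewrite exprMn; move: Kbig; rewrite FE.
  set A1 := zeta * _ / _ * _; set A2 := zeta * L * _.
  have -> : A1 = A2 by rewrite /A1 /A2; field; rewrite !gt_eqF.
  by move=> /lt_le_trans /[apply]; rewrite ltxx.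
(* Now the case of small values on [C]. A point of [C] serves as the comparison point in (HJ). *)
have [y' Cy'] : exists y', C y'.
  apply: contrapT => /forallNP C0; move: lamT.
  have -> : [set: X] = ~` C by apply/seteqP; split => z // _; exact: C0.
  by rewrite lamC lee_fin; apply/negP; rewrite -ltNge invr_gt0 !mulr_gt0.
have a2r : 0 < alpha2 * r by rewrite mulr_gt0.
have CB' : C `<=` rball rho y (alpha0 ^+ k * (alpha2 * r)).
  by apply: subset_trans CB _; apply: le_rball; rewrite /s -mulrA ler_pM2r.
have CB2 : C `<=` rball rho y (alpha2 ^+ 2 * r).
  by apply: subset_trans CB _; apply: le_rball; rewrite /s expr2 ler_pM2r// ler_pM2r.
have a2rr : alpha2 * r <= r by rewrite ger_pMl// ltW.
(* The ratio of [s] to [alpha2 * r] is exactly [a], so the hitting bound is [p], whatever [y] is. *)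
have pC : (p%:E <= mu (rball rho y (alpha2 * r) `\` C) y C)%E.
  have a2R : ((alpha2 * r)%:E < R0 rho X0 y)%E by apply: ltR0; exact: le_lt_trans a2rr rr0.
  have yb : rball rho y (alpha0 ^+ k * (alpha2 * r)) y.
    by apply: rball_center => //; rewrite mulr_gt0.
  have hit := @hitting_lower_bound _ _ _ _ _ _ _ _ _ _ _ _ _ rho_metric rho_borel
    muH Gker G1H G2H k y (alpha2 * r) C y lam hM ak a2r a2R cC CB' yb lamC lam1.
  apply: le_trans hit.
  have sa : s <= alpha2 * r by rewrite /s -mulrA ger_pMl// (le_trans aa2)// ltW.
  have := hitting_ratio G2H c2_gt0 cDb sp sa.
  have -> : s / (alpha2 * r) = a by rewrite /s; field; rewrite !gt_eqF.
  rewrite -pE -lee_fin => /le_trans; apply; rewrite EFinM lee_pmul2l// lte_fin.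
  by rewrite !mulr_gt0// ?invr_gt0// (G2_fine_gt0 G2H).
have tower : cintegral_is (mu (rball rho y (alpha2 * r) `\` C) y)
    (fun z => (v z)%:E) (v y)%:E.
  apply: tw; first by apply: ropenD => //; exact: ropen_rball.
  by move=> z [+ _]; apply: rball_subset => //; rewrite -/r0; move: xy a2rr rr0 r00; clear; lra.
have clW : rclosure rho (rball rho y r) `<=` rball rho x0 Rr.
  apply: subset_trans (clr r0 r0Rr).
  by apply: rclosureS; apply: rball_subset => //; move: xy rr0 r00; clear; lra.
have p1 : 0 < 1 - p / 4 by move: p4; clear; lra.
have p8 : 0 < 1 - p / 8 by move: p4; clear; lra.
(* Moving from [y] to [z] shrinks the weight at most by [(1 - theta) ^+ b], which is at least
   [1 - p / 8] by Bernoulli; near maximality costs another [1 - p / 8], and the product is at least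
   [1 - p / 4]. *)
have vS z : rball rho y r z -> v z <= L / (1 - p / 4).
  move=> yz; rewrite ler_pdivlMr//.
  have Wz := rW _ yz.
  have Dz : (1 - theta) * q <= D z / r0.
    rewrite /q mulrA ler_pM2r ?invr_gt0// mulrBl mul1r -/r /D.
    by have := rhoD x0 y z; move: yz; rewrite /rball /=; clear; lra.
  have q0' : 0 <= (1 - theta) * q by rewrite mulr_ge0 ?ltW// subr_gt0 (le_lt_trans tha2).
  have le1 : v z * ((1 - theta) ^+ b * q ^+ b) <= S.
    apply: le_trans (FS _ Wz); rewrite /F -exprMn ler_wpM2l// lerXn2r// nnegrE//.
    exact: le_trans Dz.
  have ber : 1 - p / 8 <= (1 - theta) ^+ b.
    apply: le_trans (bernoulli_1B b (ltW th0) (le_trans tha2 (ltW a21))).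
    by rewrite lerD2l lerN2.
  have le2 : v z * ((1 - p / 8) * q ^+ b) * (1 - p / 8) <= L * q ^+ b.
    apply: (@le_trans _ _ ((1 - p / 8) * S)); last by rewrite -FE ltW.
    rewrite mulrC ler_pM2l//.
    by apply: le_trans le1; rewrite ler_wpM2l// ler_pM2r.
  rewrite -(ler_pM2r qb0); apply: le_trans le2.
  have -> : v z * ((1 - p / 8) * q ^+ b) * (1 - p / 8) =
      v z * (1 - p / 8) ^+ 2 * q ^+ b by ring.
  rewrite ler_pM2r// ler_wpM2l//.
  have : 0 <= (p / 8) ^+ 2 by rewrite sqr_ge0.
  by rewrite sqrrB expr1n; move: ((p / 8) ^+ 2) => p2; clear; lra.
have := growth_step rho_metric rho_borel muH HJH hh y0X rp rR0 clW cC CB2 Cy' hC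
  v0 vh vS tower pC.
rewrite -/L.
(* After division by [L] the growth step would give [1 <= p / 2 + (1 - p) / (1 - p / 4)], which
   fails for [0 < p <= 1 / 4]. *)
have -> : zeta * L + L / (1 - p / 4) * (1 - p) + cJ * (zeta * L) =
    L * ((1 + cJ) * zeta + (1 - p) / (1 - p / 4)).
  by field; rewrite gt_eqF//; move: p4; clear; lra.
rewrite zEp -[leLHS]mulr1 ler_pM2l//.
rewrite -(ler_pM2r p1) mul1r mulrDl mulfVK ?gt_eqF//.
have : 0 <= p ^+ 2 by rewrite sqr_ge0.
have -> : p / 2 * (1 - p / 4) = p / 2 - p ^+ 2 / 8 by field.
by move: (p ^+ 2) p0 => p2; clear; lra.
Qed.

Theorem theorem4p10 (R : realType) (d : measure_display) (X : measurableType d)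
  (rho : X -> X -> R) (X0 : set X)
  (mu : set X -> X -> {finite_measure set X -> \bar R})
  (G : X -> X -> \bar R) (g : R -> \bar R)
  (c1 c cD M0 alpha0 c2 alpha2 cJ : R) :
  is_metric rho -> separable rho -> borel_space rho -> ropen rho X0 ->
  harmonic_family rho mu -> Gkernel G ->
  G1 rho X0 mu G c1 -> G2 rho G g c cD M0 alpha0 -> G3 rho X0 G g c2 ->
  HJ rho X0 mu alpha2 cJ ->
  forall k : nat,
    Num.max (2 * cD ^+ 2 * c ^+ 2 * c1 ^+ 2) (3 * c * c2) <= M0 ^+ k ->
    alpha0 ^+ k < 1 / 4 ->
  forall alpha : R, 0 < alpha -> alpha <= Num.min (alpha0 ^+ k) alpha2 / 4 ->
  exists K : R, 1 <= K /\
    forall (x : X) (Rr : R), X0 x -> 0 < Rr -> (Rr%:E < R0 rho X0 x)%E ->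
    forall h : X -> R, harmonic_pos rho mu (rball rho x Rr) h ->
      (ereal_sup [set (h y)%:E | y in rball rho x (alpha * Rr)]
        <= K%:E * ereal_inf [set (h y)%:E | y in rball rho x (alpha * Rr)])%E.
Proof.
move=> rhoM _ rhoB _ muH Gker G1H G2H G3H HJH k hM ak alpha alpha0' alphaE.
have {}hM : 2 * cD ^+ 2 * c ^+ 2 * c1 ^+ 2 <= M0 ^+ k.
  by apply: le_trans hM; rewrite le_max lexx.
have c_ge1 : 1 <= c by case: G2H.
have c2_ge1 : 1 <= c2 by case: G3H.
have [a20 a21] : 0 < alpha2 /\ alpha2 < 1 by case: HJH => /andP[].
have cJ_ge1 : 1 <= cJ by case: HJH => _ [].
set a := Num.min (alpha0 ^+ k) alpha2 in alphaE.
have aM0 : 0 < alpha0 ^+ k.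
  by case: G2H => _ [_ [_ [/andP[a0 _] _]]]; rewrite exprn_gt0.
have a0 : 0 < a by rewrite lt_min aM0.
have aaM : a <= alpha0 ^+ k by rewrite ge_min lexx.
have aa2 : a <= alpha2 by rewrite ge_min lexx orbT.
have [b cDb] : exists b : nat, cD <= 2 ^+ b.
  exists (Num.truncn cD).+1; apply: le_trans (ltW (Num.Theory.truncnS_gt _)) _.
  by rewrite -natrX ler_nat ltnW// ltn_expl.
pose p := a ^+ b / (4 * c * c2).
have cc2 : 4 <= 4 * c * c2.
  by rewrite -mulrA ler_peMr// mulr_ege1.
have ccp : 0 < 4 * c * c2 by exact: lt_le_trans cc2.
have p0 : 0 < p by rewrite divr_gt0// exprn_gt0.
have p4 : p <= 1 / 4.
  rewrite /p ler_pdivrMr//; apply: (@le_trans _ _ 1).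
    by rewrite exprn_ile1 ?ltW// (le_lt_trans aa2).
  by rewrite mul1r mulrC ler_pdivlMr// mul1r.
(* Chosen so that [(1 + cJ) * zeta = p / 2]: the terms [t] and [cJ * t] of the growth step use up
   only half of the gain [p]. *)
pose zeta := p / (2 * (1 + cJ)).
(* Small enough for [b%:R * theta <= p / 8]; the successor of [b] avoids a zero denominator when
   [b = 0]. *)
pose theta := Num.min alpha2 (p / (8 * b.+1%:R)).
have b8 : 0 < 8 * b.+1%:R :> R by rewrite mulr_gt0.
have th0 : 0 < theta by rewrite lt_min a20 divr_gt0.
have tha2 : theta <= alpha2 by rewrite ge_min lexx.
have thp : theta <= p / (8 * b.+1%:R) by rewrite ge_min lexx orbT.
have bth : b%:R * theta <= p / 8.
  apply: (@le_trans _ _ (b.+1%:R * (p / (8 * b.+1%:R)))).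
    by apply: ler_pM => //; [exact: ltW|rewrite ler_nat].
  have n0 : b.+1%:R != 0 :> R by rewrite pnatr_eq0.
  by rewrite le_eqVlt; apply/orP; left; move: (b.+1%:R) n0 => n n0; apply/eqP; field.
have th2 : theta <= 1 / 2.
  apply: (le_trans thp); rewrite ler_pdivrMr//.
  have : 1 <= b.+1%:R :> R by rewrite ler1n.
  lra.
pose K1 := 8 * c * c2 / (zeta * (a * alpha2 * theta) ^+ b).
(* On the ball of radius [alpha * Rr] the distance to the boundary of the weighted ball is at least
   half its radius, so the weight is at least [(alpha0 ^+ k / 2) ^+ b]; the second factor undoes
   it. *)
pose K := K1 * (2 / alpha0 ^+ k) ^+ b.
exists (Num.max 1 K); split; first by rewrite le_max lexx.
move=> x Rr Xx Rr0 RrR h hh.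
have h0 y : 0 <= h y by case: hh.
have Rr2 : 0 < Rr / 2 by rewrite divr_gt0.
have aMr : alpha0 ^+ k * (Rr / 2) < Rr / 2 by rewrite gtr_pMl//; lra.
have inW y : rball rho x (alpha * Rr) y ->
    rho x y <= alpha0 ^+ k * (Rr / 2) / 2.
  rewrite /rball /= => /ltW /le_trans; apply.
  have -> : alpha0 ^+ k * (Rr / 2) / 2 = alpha0 ^+ k / 4 * Rr by field.
  by rewrite ler_pM2r// (le_trans alphaE)// ler_pM2r// invr_gt0.
have ballW y : rball rho x (alpha * Rr) y ->
    rball rho x (alpha0 ^+ k * (Rr / 2)) y.
  move=> /inW xy; apply: le_lt_trans xy _.
  by rewrite gtr_pMr ?mulr_gt0// invf_lt1// ltr1n.
set U := rball rho x (Rr / 2).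
have oU : ropen rho U by exact: ropen_rball.
have clU : rclosure rho U `<=` rball rho x Rr by apply: rclosure_rball => //; lra.
have main y z : rball rho x (alpha * Rr) y -> rball rho x (alpha * Rr) z ->
    h y <= K * h z.
  move=> by_ bz; have Wy := ballW _ by_; have Wz := ballW _ bz.
  have Uy : U y by exact: lt_trans Wy aMr.
  (* The bound to be shown for the exit integral depends neither on [f] nor on the bound [m] of its
     exit integrals, so it passes to [h]. *)
  apply: (harmonic_le_of_exit_integral hh oU clU Uy) => f fh.
  have [m hm] := exit_integral_bounded muH f oU.
  pose v w := fine (\int[mu U w]_t (f t)%:E)%E.
  have vE w : (v w)%:E = (\int[mu U w]_t (f t)%:E)%E.
    rewrite fineK// ge0_fin_numE; first exact: le_lt_trans (hm w) (ltry _).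
    by apply: integral_ge0 => t _; rewrite lee_fin.
  have v0 w : 0 <= v w.
    by rewrite fine_ge0//; apply: integral_ge0 => t _; rewrite lee_fin.
  have vh w : v w <= h w.
    by rewrite -lee_fin vE; exact: exit_integral_le_harmonic hh oU clU fh.
  have vm w : v w <= m by rewrite -lee_fin vE.
  have tw V w : ropen rho V -> V `<=` U ->
      cintegral_is (mu V w) (fun t => (v t)%:E) (v w)%:E.
    move=> oV VU; rewrite vE (_ : (fun t => _) = fun t => \int[mu U t]_y (f y)%:E)%E.
      exact: (exit_integral_tower muH).
    by apply/funext => t; exact: vE.
  have := @weighted_sup_bound _ _ _ _ _ _ _ _ _ _ _ _ _ _ _ _ k b a p zeta theta x Rr h v m z
    rhoM rhoB muH Gker
    G1H G2H G3H HJH hM ak cDb a0 aaM aa2 erefl p4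
    erefl th0 tha2 th2 bth Xx Rr0 RrR hh v0 vh vm tw Wz y Wy.
  rewrite -/K1 => bound; rewrite -vE lee_fin.
  have q0 : 0 < (alpha0 ^+ k / 2) ^+ b by rewrite exprn_gt0// divr_gt0.
  rewrite -(ler_pM2r q0).
  have -> : K * h z * (alpha0 ^+ k / 2) ^+ b = K1 * h z.
    have -> : K = K1 * ((alpha0 ^+ k / 2) ^+ b)^-1 by rewrite -exprVn invf_div.
    by field; rewrite gt_eqF.
  apply: le_trans bound; rewrite ler_wpM2l//; apply: lerXn2r; rewrite ?nnegrE.
  - by rewrite ltW// divr_gt0.
  - by rewrite ltW// divr_gt0// subr_gt0.
  - rewrite ler_pdivlMr//; have := inW _ by_.
    have -> : alpha0 ^+ k / 2 * (Rr / 2) = alpha0 ^+ k * (Rr / 2) / 2 by field.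
    by move: (alpha0 ^+ k * (Rr / 2)) => t; lra.
have Kp : 0 < Num.max 1 K by rewrite lt_max ltr01.
rewrite -lee_pdivrMl//; apply: le_ereal_inf_tmp => _ [z bz <-].
rewrite lee_pdivrMl//; apply: ge_ereal_sup => _ [y by_ <-].
rewrite -EFinM lee_fin; apply: le_trans (main _ _ by_ bz) _.
by rewrite ler_wpM2r// le_max lexx orbT.
Qed.
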